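(* Let $\Omega\subset\mathbb{R}^d$ be a domain and $T>0$. Let $\phi\in C_c^1(\Omega\times[0,T])$ be a nonnegative function whose support is contained in a relatively open subset $\mathcal{O}\subset\Omega\times[0,T]$. Let $(u,p)\in L^3_{loc}(\mathcal{O})\times L^{3/2}_{loc}(\mathcal{O})$ be an admissible weak solution in $\mathcal{O}$ of the incompressible Euler equations, let $(U,P)\in C^1(\overline{\mathcal{O}})$ be a local strong solution in $\mathcal{O}$ of the incompressible Euler equations, and assume that $u$ and $U$ coincide on $\mathcal{O}\cap\{t=0\}$, where they take the value $u^0\in C^1(\overline{\mathcal{O}}\cap\{t=0\})$. Let $$E^\phi_{rel}(\tau)=\frac12\int_\Omega\phi(x,\tau)|u(x,\tau)-U(x,\tau)|^2\,dx .$$ Then, for almost every $\tau\in(0,T)$, $$E_{rel}^\phi(\tau)\leq\int_0^\tau\int_\Omega\left(\frac12\partial_t\phi\, |U-u|^2+\nabla\phi\cdot\left[\frac{|U-u|^2}{2}u+(P-p)(U-u)\right]\right) dx\,dt+2\int_0^\tau\|\nabla_{sym}U(t)\|_{L^\infty(\mathcal{O})}E^\phi_{rel}(t)\,dt.$$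
   Context: The domain $\Omega\subset\mathbb{R}^d$ ($d\ge1$) is not necessarily bounded and no boundary conditions are imposed. The incompressible Euler equations are $$\partial_t u+\operatorname{div}(u\otimes u)+\nabla p=0,\qquad \operatorname{div}u=0,$$ with velocity $u$ ($\mathbb{R}^d$-valued) and scalar pressure $p$. For a relatively open $\mathcal{O}\subset\Omega\times[0,T]$, ''$loc$'' means integrability on compact subsets of $\mathcal{O}$, and $C_c^1(\mathcal{O})$ denotes $C^1$ functions with compact support in $\mathcal{O}$ (they need not vanish at $t=0$ or $t=T$), extended by zero to $\Omega\times[0,T]$. All integrands below, being multiplied by a test function or its derivatives, are understood to be zero outside the support of that test function (the solutions need not be defined outside $\mathcal{O}$). Local strong solution in $\mathcal{O}$: a pair $(U,P)\in C^1(\overline{\mathcal{O}})$ (i.e. $C^1$ with values and first derivatives continuous up to the closure) satisfying the equations pointwise at every $(x,t)\in\mathcal{O}$. Local weak solution in $\mathcal{O}$ with initial datum $u^0$ on $\mathcal{O}\cap\{t=0\}$: a pair $(u,p)\in L^3_{loc}(\mathcal{O};\mathbb{R}^d)\times L^{3/2}_{loc}(\mathcal{O})$ such that for almost every $\tau\in(0,T)$ and every $\zeta\in C_c^1(\mathcal{O};\mathbb{R}^d)$, $$\int_0^\tau\!\!\int_\Omega \partial_t\zeta\cdot u+\nabla\zeta:(u\otimes u)+p\operatorname{div}\zeta\,dx\,dt=\int_\Omega u(x,\tau)\cdot\zeta(x,\tau)-u^0(x)\cdot\zeta(x,0)\,dx,$$ and $\int_\Omega u(x,\tau)\cdot\nabla\psi(x,\tau)\,dx=0$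 for almost every $\tau\in(0,T)$ and every $\psi\in C_c^1(\mathcal{O})$. Admissible weak solution in $\mathcal{O}$: a local weak solution in $\mathcal{O}$ that satisfies the local energy inequality in $\mathcal{O}$: for every nonnegative $\chi\in C_c^1(\mathcal{O})$ and almost every $\tau\in(0,T)$, $$\int_0^\tau\!\!\int_\Omega\frac12\partial_t\chi|u|^2+\nabla\chi\cdot\left[\left(\frac{|u|^2}{2}+p\right)u\right]dx\,dt\ge\frac12\int_\Omega\chi(x,\tau)|u(x,\tau)|^2dx-\frac12\int_\Omega\chi(x,0)|u^0(x)|^2dx.$$ $\nabla_{sym}U=\frac12(\nabla U+(\nabla U)^{T})$ is the symmetric part of the spatial gradient, and $\|\nabla_{sym}U(t)\|_{L^\infty(\mathcal{O})}$ is the supremum of $|\nabla_{sym}U(x,t)|$ (matrix operator norm) over $\{x:(x,t)\in\mathcal{O}\}$, with value in $[0,\infty]$ and the convention $0\cdot\infty=0$. *)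

(* Defs.v *)
From HB Require Import structures.
From mathcomp Require Import all_boot all_order all_algebra.
From mathcomp Require Import all_classical all_reals all_analysis.

Set Implicit Arguments.
Unset Strict Implicit.
Unset Printing Implicit Defensive.

Import Order.TTheory GRing.Theory Num.Theory.
Import numFieldNormedType.Exports.

Local Open Scope classical_set_scope.
Local Open Scope ring_scope.

Definition measure_mx_display : measure_display -> measure_display.
Proof. exact. Qed.

Section measurable_matrix.
Context {d} {T : measurableType d}.
Variables m n : nat.

Definition mx_cylinders : set (set 'M[T]_(m, n)) :=
  [set A | exists i j, exists2 B : set T,
     measurable B & A = (fun M : 'M[T]_(m, n) => M i j) @^-1` B].

Let mx_set0 : <<s mx_cylinders >> set0.
Proof. exact: sigma_algebra0. Qed.

Let mx_setC A : <<s mx_cylinders >> A -> <<s mx_cylinders >> (~` A).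
Proof. exact: sigma_algebraC. Qed.

Let mx_bigcup (F : (set _)^nat) : (forall i, <<s mx_cylinders >> (F i)) ->
  <<s mx_cylinders >> (\bigcup_i (F i)).
Proof. exact: sigma_algebra_bigcup. Qed.

HB.instance Definition _ := @isMeasurable.Build (measure_mx_display d)
  'M[T]_(m, n) <<s mx_cylinders >> mx_set0 mx_setC mx_bigcup.

End measurable_matrix.

Lemma measurable_coord d (T : measurableType d) m n i j :
  measurable_fun [set: 'M[T]_(m, n)] (fun M => M i j).
Proof.
move=> _ B mB; rewrite setTI; apply: sub_sigma_algebra.
by exists i, j, B.
Qed.

Lemma measurable_fun_mxP d d' (S : measurableType d') (T : measurableType d)
    m n (f : S -> 'M[T]_(m, n)) :
  (forall i j, measurable_fun [set: S] (fun x => f x i j)) ->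
  measurable_fun [set: S] f.
Proof.
move=> mf; apply: (measurability (@mx_cylinders d T m n)) => // _ [_ [i [j [B mB ->]]] <-].
exact: mf.
Qed.

Section lebesgue_rV.
Variable R : realType.
Notation lam := (@lebesgue_measure R).

Definition cons_rV n (p : R * 'rV[R]_n) : 'rV[R]_n.+1 := row_mx p.1%:M p.2.
Definition uncons_rV n (v : 'rV[R]_n.+1) : R * 'rV[R]_n :=
  (v 0 0, \row_j v 0 (lift 0 j)).

Lemma cons_rVl n p : @cons_rV n p 0 0 = p.1.
Proof.
transitivity (row_mx p.1%:M p.2 0 (lshift n 0)).
  by congr (row_mx _ _ _ _); exact/val_inj.
by rewrite row_mxEl mxE eqxx mulr1n.
Qed.

Lemma cons_rVr n p j : @cons_rV n p 0 (lift 0 j) = p.2 0 j.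
Proof.
transitivity (row_mx p.1%:M p.2 0 (rshift 1 j)); last by rewrite row_mxEr.
by congr (row_mx _ _ _ _); exact/val_inj.
Qed.

Lemma cons_rVK n : cancel (@cons_rV n) (@uncons_rV n).
Proof.
move=> [x v]; rewrite /uncons_rV cons_rVl; congr pair.
by apply/rowP => j; rewrite mxE cons_rVr.
Qed.

Lemma uncons_rVK n : cancel (@uncons_rV n) (@cons_rV n).
Proof.
move=> v; apply/rowP => j; case: (unliftP 0 j) => [k|] ->.
  by rewrite cons_rVr mxE.
by rewrite cons_rVl.
Qed.

Lemma measurable_cons_rV n : measurable_fun setT (@cons_rV n).
Proof.
apply: measurable_fun_mxP => i j; rewrite ord1.
case: (unliftP 0 j) => [k|] ->.
  under eq_fun do rewrite cons_rVr.
  apply: (measurableT_comp (f := fun v : 'rV[R]_n => v 0 k)) => //.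
  exact: measurable_coord.
under eq_fun do rewrite cons_rVl.
exact: measurable_fst.
Qed.

Lemma measurable_uncons_rV n : measurable_fun setT (@uncons_rV n).
Proof.
apply: measurable_fun_pair => /=; first exact: measurable_coord.
apply: measurable_fun_mxP => i j.
under eq_fun do rewrite mxE.
exact: measurable_coord.
Qed.

Section cons_measure.
Local Open Scope ereal_scope.
Variable n : nat.
Variable mu : {sigma_finite_measure set 'rV[R]_n -> \bar R}.

Definition cons_measure : set 'rV[R]_n.+1 -> \bar R :=
  pushforward (lam \x mu) (@cons_rV n).

Let mpre A : measurable A -> measurable (@cons_rV n @^-1` A).
Proof. by move=> mA; rewrite -[X in measurable X]setTI; exact: measurable_cons_rV. Qed.

Let cons_measure0 : cons_measure set0 = 0.
Proof. by rewrite /cons_measure /pushforward preimage_set0 measure0. Qed.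

Let cons_measure_ge0 A : 0 <= cons_measure A.
Proof. by rewrite /cons_measure /pushforward; apply: measure_ge0. Qed.

Let cons_measure_additive : semi_sigma_additive cons_measure.
Proof.
move=> F mF tF mUF; rewrite /cons_measure /pushforward preimage_bigcup.
apply: measure_semi_sigma_additive.
- by move=> k; exact: mpre.
- apply/trivIsetP => /= i j _ _ ij; rewrite -preimage_setI.
  by move/trivIsetP : tF => /(_ _ _ _ _ ij) ->//; rewrite preimage_set0.
- by rewrite -preimage_bigcup; exact: mpre.
Qed.

HB.instance Definition _ := isMeasure.Build _ _ _ cons_measure
  cons_measure0 cons_measure_ge0 cons_measure_additive.

Let cons_measure_sigma_finite : sigma_finite setT cons_measure.
Proof.
have /sigma_finiteP[F [TF ndF Foo]] := sigma_finiteT lam.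
have /sigma_finiteP[G [TG ndG Goo]] := sigma_finiteT mu.
exists (fun k => @uncons_rV n @^-1` (F k `*` G k)).
  rewrite -preimage_bigcup (_ : \bigcup_k _ = setT) ?preimage_setT//.
  apply/seteqP; split => // -[x v] _.
  have [i _ Fx] : (\bigcup_i F i) x by rewrite -TF.
  have [j _ Gv] : (\bigcup_i G i) v by rewrite -TG.
  exists (maxn i j) => //; split => /=.
    by move: x Fx; exact/subsetPset/ndF/leq_maxl.
  by move: v Gv; exact/subsetPset/ndG/leq_maxr.
move=> k; have [mF Fk] := Foo k; have [mG Gk] := Goo k; split.
  rewrite -[X in measurable X]setTI; apply: measurable_uncons_rV => //.
  exact: measurableX.
rewrite /cons_measure /pushforward -comp_preimage.
rewrite (_ : _ \o _ = idfun); last by apply/funext => p /=; rewrite cons_rVK.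
by rewrite preimage_id product_measure1E// lte_mul_pinfty// ge0_fin_numE.
Qed.

HB.instance Definition _ := Measure_isSigmaFinite.Build _ _ _ cons_measure
  cons_measure_sigma_finite.

End cons_measure.

(* d-dimensional Lebesgue measure; see [lebesgue_rV_box]. *)
Fixpoint lebesgue_rV n : {sigma_finite_measure set 'rV[R]_n -> \bar R} :=
  if n is n'.+1 then cons_measure (lebesgue_rV n') else \d_ (0 : 'rV[R]_0).

Lemma lebesgue_rV_box n (A : 'I_n -> set R) : (forall i, measurable (A i)) ->
  lebesgue_rV n [set v : 'rV[R]_n | forall i, A i (v 0 i)]
  = (\prod_(i < n) lam (A i))%E.
Proof.
elim: n A => [|n IH] A mA.
  by rewrite big_ord0 /= diracE mem_set// => -[].
rewrite big_ord_recl -IH; last by move=> i; exact: mA.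
have mB : measurable [set v : 'rV[R]_n | forall i, A (lift 0 i) (v 0 i)].
  rewrite (_ : [set _ | _] = \bigcap_(i in [set: 'I_n])
      ((fun v : 'rV[R]_n => v 0 i) @^-1` A (lift 0 i))).
    apply: fin_bigcap_measurable => // i _; rewrite -[X in measurable X]setTI.
    exact: measurable_coord.
  apply/seteqP; split => v /= H i; first by move=> _; exact: H.
  exact: H.
transitivity ((lam \x lebesgue_rV n)%E
    (A 0 `*` [set v : 'rV[R]_n | forall i, A (lift 0 i) (v 0 i)])); last first.
  by rewrite product_measure1E//; exact: mA.
rewrite /= /cons_measure /pushforward; congr ((lam \x lebesgue_rV n)%E _).
apply/seteqP; split => -[x v] /= H.
  split => [|i]; first by have := H 0; rewrite cons_rVl.
  by have := H (lift 0 i); rewrite cons_rVr.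
move=> i; case: H => /= H0 H1.
by case: (unliftP 0 i) => [k|] ->; rewrite ?cons_rVr ?cons_rVl.
Qed.

End lebesgue_rV.

Section calculus.
Variables (R : realType) (d : nat) (T : R).
Local Notation E := ('rV[R]_d * R)%type.

(* [dx i f z] only uses values of [f] at the time [z.2]; [dt f z] is the time
   derivative relative to [0, T], hence one-sided for [z.2 = 0] and [z.2 = T]. *)
Definition dx_dir (i : 'I_d) : E := (delta_mx 0 i, 0).
Definition dx (i : 'I_d) (f : E -> R) (z : E) : R := 'D_(dx_dir i) f z.
Definition dx_derivable (i : 'I_d) (f : E -> R) (z : E) : Prop :=
  derivable f z (dx_dir i).

Definition dt_quotient (f : E -> R) (z : E) (h : R) : R :=
  h^-1 * (f (z.1, z.2 + h) - f z).
Definition dt_nbhs (t : R) : set_system R :=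
  within [set h | 0 <= t + h <= T] (0^').
Definition dt (f : E -> R) (z : E) : R :=
  lim (dt_quotient f z @ dt_nbhs z.2).
Definition dt_derivable (f : E -> R) (z : E) : Prop :=
  cvg (dt_quotient f z @ dt_nbhs z.2).

Definition C1_on (Q : set E) (f : E -> R) : Prop :=
  [/\ {within Q, continuous f},
      (forall z, Q z -> dt_derivable f z) /\ {within Q, continuous (dt f)}
    & forall i, (forall z, Q z -> dx_derivable i f z) /\
        {within Q, continuous (dx i f)}].

Definition tsupport (f : E -> R) : set E := closure [set z | f z != 0].

(* The support is a subset of [A], so [f] is extended by zero outside [A]. *)
Definition C1_compact (A : set E) (f : E -> R) : Prop :=
  [/\ C1_on A f, compact (tsupport f) & tsupport f `<=` A].

Definition extends_continuously (X : topologicalType) (A B : set X)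
    (f : X -> R) : Prop :=
  exists2 g : X -> R, {within B, continuous g} & forall x, A x -> g x = f x.

Definition C1_closure (Q : set E) (f : E -> R) : Prop :=
  [/\ C1_on Q f, extends_continuously Q (closure Q) f,
      extends_continuously Q (closure Q) (dt f)
    & forall i, extends_continuously Q (closure Q) (dx i f)].

Definition initial_slice (A : set E) : set 'rV[R]_d := [set x | A (x, 0)].

Definition C1_initial (Q : set E) (f : 'rV[R]_d -> R) : Prop :=
  [/\ {within initial_slice Q, continuous f},
      extends_continuously (initial_slice Q) (initial_slice (closure Q)) f
    & forall i : 'I_d,
      let df x := 'D_(delta_mx 0 i) f x in
      [/\ forall x, initial_slice Q x -> derivable f x (delta_mx 0 i),
          {within initial_slice Q, continuous df}
        & extends_continuously (initial_slice Q) (initial_slice (closure Q)) df]].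

Definition component (i : 'I_d) (u : E -> 'rV[R]_d) (z : E) : R := u z 0 i.

Definition dot (v w : 'rV[R]_d) : R := \sum_i v 0 i * w 0 i.
Definition enorm (v : 'rV[R]_d) : R := Num.sqrt (dot v v).

Definition grad (f : E -> R) (z : E) : 'rV[R]_d := \row_i dx i f z.
Definition div (u : E -> 'rV[R]_d) (z : E) : R := \sum_i dx i (component i u) z.
Definition dt_vec (u : E -> 'rV[R]_d) (z : E) : 'rV[R]_d :=
  \row_i dt (component i u) z.
Definition jac (u : E -> 'rV[R]_d) (z : E) : 'M[R]_d :=
  \matrix_(i, j) dx j (component i u) z.
Definition sym_grad (u : E -> 'rV[R]_d) (z : E) : 'M[R]_d :=
  2^-1 *: (jac u z + (jac u z)^T).

Definition tensor (v w : 'rV[R]_d) : 'M[R]_d := \matrix_(i, j) (v 0 i * w 0 j).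
Definition frob (A B : 'M[R]_d) : R := \sum_i \sum_j A i j * B i j.
Definition div_tensor (A : E -> 'M[R]_d) (z : E) : 'rV[R]_d :=
  \row_i \sum_j dx j (fun y => A y i j) z.

(* Vectors are rows: [v *m A^T] is the transpose of A v. *)
Definition op_norm (A : 'M[R]_d) : R :=
  sup [set enorm (v *m A^T) | v in [set v | enorm v <= 1]].

(* Adding 0 to the set gives the value 0 when the time slice of [Q] is empty. *)
Definition sym_grad_sup (Q : set E) (U : E -> 'rV[R]_d) (t : R) : \bar R :=
  ereal_sup ([set 0%E] `|`
    [set (op_norm (sym_grad U (x, t)))%:E | x in [set x | Q (x, t)]]).

End calculus.

Section euler.
Variables (R : realType) (d : nat) (Omega : set 'rV[R]_d) (T : R).
Local Notation E := ('rV[R]_d * R)%type.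
Local Notation lam := (@lebesgue_measure R).
Local Notation leb := (lebesgue_rV R d).

Definition cylinder : set E := Omega `*` [set t | 0 <= t <= T].

Definition rel_open (Q : set E) : Prop :=
  exists2 V : set E, open V & Q = V `&` cylinder.

Definition space_int (f : 'rV[R]_d -> R) : \bar R :=
  (\int[leb]_(x in Omega) (f x)%:E)%E.

Definition spacetime_int (tau : R) (f : E -> R) : \bar R :=
  (\int[lam]_(t in `[0%R, tau]) space_int (fun x => f (x, t)))%E.

Definition Lq_loc_norm (q : R) (Q : set E) (N : E -> R) : Prop :=
  forall K : set E, compact K -> K `<=` Q ->
    (\int[leb \x lam]_(z in K) (N z `^ q)%:E < +oo)%E.

Definition L3_loc (Q : set E) (u : E -> 'rV[R]_d) : Prop :=
  measurable_fun Q u /\ Lq_loc_norm 3 Q (fun z => enorm (u z)).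

Definition L32_loc (Q : set E) (p : E -> R) : Prop :=
  measurable_fun Q p /\ Lq_loc_norm (3 / 2) Q (fun z => `|p z|).

Definition strong_solution (Q : set E) (U : E -> 'rV[R]_d) (P : E -> R) : Prop :=
  [/\ forall i, C1_closure T Q (component i U), C1_closure T Q P
    & forall z, Q z ->
        dt_vec T U z + div_tensor (fun y => tensor (U y) (U y)) z + grad P z = 0
        /\ div U z = 0].

(* Solutions are total functions with arbitrary values outside [Q]; the test
   functions and their derivatives vanish there, and so do the integrands. *)
Definition weak_momentum (Q : set E) (u : E -> 'rV[R]_d) (p : E -> R)
    (u0 : 'rV[R]_d -> 'rV[R]_d) : Prop :=
  {ae lam, forall tau : R, 0 < tau < T ->
    forall zeta : E -> 'rV[R]_d, (forall i, C1_compact T Q (component i zeta)) ->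
    spacetime_int tau (fun z => dot (dt_vec T zeta z) (u z)
      + frob (jac zeta z) (tensor (u z) (u z)) + p z * div zeta z)
    = space_int (fun x => dot (u (x, tau)) (zeta (x, tau))
        - dot (u0 x) (zeta (x, 0)))}.

Definition weak_incompressible (Q : set E) (u : E -> 'rV[R]_d) : Prop :=
  {ae lam, forall tau : R, 0 < tau < T ->
    forall psi : E -> R, C1_compact T Q psi ->
    space_int (fun x => dot (u (x, tau)) (grad psi (x, tau))) = 0%E}.

Definition weak_solution (Q : set E) (u : E -> 'rV[R]_d) (p : E -> R)
    (u0 : 'rV[R]_d -> 'rV[R]_d) : Prop :=
  [/\ L3_loc Q u, L32_loc Q p, weak_momentum Q u p u0 & weak_incompressible Q u].

Definition local_energy_inequality (Q : set E) (u : E -> 'rV[R]_d) (p : E -> R)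
    (u0 : 'rV[R]_d -> 'rV[R]_d) : Prop :=
  forall chi : E -> R, C1_compact T Q chi -> (forall z, 0 <= chi z) ->
  {ae lam, forall tau : R, 0 < tau < T ->
    (spacetime_int tau (fun z => 2^-1 * dt T chi z * enorm (u z) ^+ 2
       + dot (grad chi z) ((enorm (u z) ^+ 2 / 2 + p z) *: u z))%R
     >= 2^-1%:E * space_int (fun x => chi (x, tau) * enorm (u (x, tau)) ^+ 2)%R
        - 2^-1%:E * space_int (fun x => chi (x, 0) * enorm (u0 x) ^+ 2)%R)%E}.

Definition admissible_weak_solution (Q : set E) (u : E -> 'rV[R]_d)
    (p : E -> R) (u0 : 'rV[R]_d -> 'rV[R]_d) : Prop :=
  weak_solution Q u p u0 /\ local_energy_inequality Q u p u0.

Definition rel_energy (phi : E -> R) (u U : E -> 'rV[R]_d) (tau : R) : \bar R :=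
  (2^-1%:E * space_int (fun x =>
     phi (x, tau) * enorm (u (x, tau) - U (x, tau)) ^+ 2)%R)%E.

End euler.

(* Main.v *)
Require Import Defs.
From mathcomp Require Import all_boot all_order all_algebra.
From mathcomp Require Import all_classical all_reals all_analysis.
From mathcomp Require Import ring lra measurable_realfun.

Set Implicit Arguments.
Unset Strict Implicit.
Unset Printing Implicit Defensive.

Import Order.TTheory GRing.Theory Num.Theory.
Import numFieldNormedType.Exports.

Local Open Scope classical_set_scope.
Local Open Scope ring_scope.

(** The relative energy of the weak solution u with respect to the strong solution
U expands as
<<
  1/2 phi |u - U|^2 = 1/2 phi |u|^2 - phi u . U + 1/2 phi |U|^2 .
>>
The first term is bounded by the local energy inequality with test function phi;
the second is computed by the weak momentum equation with test function phi U; the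
third is smooth, and the fundamental theorem of calculus in time
([spacetime_int_dt]) expresses it through its time derivative. The initial
contributions 1/2 - 1 + 1/2 of phi |u0|^2 cancel because U and u share their
initial value.

Adding the three balances gives an integrand in which the time derivative of U can
be replaced by - (U . grad) U - grad P. By a pointwise identity
([flux_identity]) what results is the integrand of the claim, plus
- phi w . (grad U) w with w = u - U, plus the three terms u . grad (phi |U|^2 / 2),
u . grad (phi P) and U . grad (phi P) up to sign. The first two integrate to zero
by weak incompressibility of u at almost every time
([spacetime_int_incompressible]), the third because it is the divergence of
phi P U ([spacetime_int_strong_pressure]). The quadratic form of grad U sees its
symmetric part only, so - phi w . (grad U) w is at most the operator norm of the
symmetric gradient times phi |w|^2 ([space_int_half_remainder_le]), that is twice
that norm times the density of the relative energy.

Two analytic ingredients support this computation. All the integrands have degree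
at most three when u counts for one and p for two, with coefficients that are
bounded on the compact support of phi; hence they are integrable
([growth_integrable]), Fubini's theorem identifies iterated and product integrals
([spacetime_intE]), and at almost every time the slices are integrable
([ae_integrable_slice]). The divergence theorem is needed for compactly supported
functions only, where it reduces, by induction on the dimension, to the
one-dimensional fundamental theorem of calculus ([integral_derive_box]). *)

(** * Euclidean algebra of row vectors *)

Section euclidean.
Variables (R : realType) (d : nat).
Implicit Types (v w x : 'rV[R]_d) (A B : 'M[R]_d) (c : R).

Lemma dotC v w : dot v w = dot w v.
Proof. by apply: eq_bigr => i _; rewrite mulrC. Qed.

Lemma dotDl v w x : dot (v + w) x = dot v x + dot w x.
Proof. by rewrite -big_split; apply: eq_bigr => i _; rewrite mxE mulrDl. Qed.

Lemma dotZl c v w : dot (c *: v) w = c * dot v w.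
Proof. by rewrite /dot mulr_sumr; apply: eq_bigr => i _; rewrite mxE mulrA. Qed.

Lemma dotNl v w : dot (- v) w = - dot v w.
Proof. by rewrite -scaleN1r dotZl mulN1r. Qed.

Lemma dotBl v w x : dot (v - w) x = dot v x - dot w x.
Proof. by rewrite dotDl dotNl. Qed.

Lemma dotDr v w x : dot x (v + w) = dot x v + dot x w.
Proof. by rewrite !(dotC x) dotDl. Qed.

Lemma dotZr c v w : dot w (c *: v) = c * dot w v.
Proof. by rewrite !(dotC w) dotZl. Qed.

Lemma dotNr v w : dot w (- v) = - dot w v.
Proof. by rewrite !(dotC w) dotNl. Qed.

Lemma dotBr v w x : dot x (v - w) = dot x v - dot x w.
Proof. by rewrite !(dotC x) dotBl. Qed.

Lemma dot0l v : dot 0 v = 0.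
Proof. by rewrite -(scale0r 0) dotZl mul0r. Qed.

Lemma dot0r v : dot v 0 = 0.
Proof. by rewrite dotC dot0l. Qed.

Lemma dot_ge0 v : 0 <= dot v v.
Proof. by apply: sumr_ge0 => i _; rewrite -expr2 sqr_ge0. Qed.

Lemma enorm_sqr v : enorm v ^+ 2 = dot v v.
Proof. by rewrite sqr_sqrtr// dot_ge0. Qed.

Lemma enorm_ge0 v : 0 <= enorm v.
Proof. exact: sqrtr_ge0. Qed.

Lemma le_enorm_coord v i : `|v 0 i| <= enorm v.
Proof.
rewrite -sqrtr_sqr ler_wsqrtr// expr2 /dot (bigD1 i)//= lerDl.
by apply: sumr_ge0 => j _; rewrite -expr2 sqr_ge0.
Qed.

(** Expand the nonnegative square of |w|^2 v - (v . w) w, a multiple of the part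
of v orthogonal to w. *)
Lemma dot_CauchySchwarz v w : `|dot v w| <= enorm v * enorm w.
Proof.
rewrite -(@ler_pXn2r _ 2)// ?nnegrE ?mulr_ge0 ?enorm_ge0//.
rewrite exprMn !enorm_sqr real_normK ?num_real//.
have [w0|w0] := eqVneq (dot w w) 0.
  have w_0 : w = 0.
    apply/rowP => i; rewrite mxE; apply/eqP; rewrite -normr_le0.
    by rewrite (le_trans (le_enorm_coord w i))// /enorm w0 sqrtr0.
  by rewrite w_0 !dot0r expr0n mulr0.
have wgt0 : 0 < dot w w by rewrite lt_neqAle eq_sym w0 dot_ge0.
have := dot_ge0 (dot w w *: v - dot v w *: w).
rewrite !(dotBl, dotBr, dotZl, dotZr) (dotC w v) => h.
rewrite -subr_ge0 -(pmulr_rge0 _ wgt0); apply: le_trans h _.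
by rewrite le_eqVlt; apply/orP; left; apply/eqP; ring.
Qed.

Lemma enorm0 : enorm (0 : 'rV[R]_d) = 0.
Proof. by rewrite /enorm dot0l sqrtr0. Qed.

Lemma enormZ c v : enorm (c *: v) = `|c| * enorm v.
Proof. by rewrite /enorm dotZl dotZr mulrA -expr2 sqrtrM ?sqr_ge0// sqrtr_sqr. Qed.

Lemma mulmxTE v A i : (v *m A^T) 0 i = dot v (row i A).
Proof. by rewrite mxE; apply: eq_bigr => j _; rewrite !mxE. Qed.

(** Cauchy-Schwarz row by row. The Frobenius constant is not sharp; it serves to
show that the supremum defining [op_norm] is taken over a bounded set, without
which [sup] would be meaningless. *)
Lemma enorm_mulmxT_le v A :
  enorm (v *m A^T) <= Num.sqrt (frob A A) * enorm v.
Proof.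
rewrite -[X in _ <= _ * X]ger0_norm ?enorm_ge0// -sqrtr_sqr enorm_sqr.
rewrite -sqrtrM; last first.
  by apply: sumr_ge0 => i _; apply: sumr_ge0 => j _; rewrite -expr2 sqr_ge0.
rewrite ler_wsqrtr// /frob mulr_suml; apply: ler_sum => i _.
rewrite mulmxTE -expr2.
have -> : \sum_j A i j * A i j = dot (row i A) (row i A).
  by apply: eq_bigr => j _; rewrite !mxE.
rewrite -!enorm_sqr -exprMn -[leLHS]real_normK ?num_real//.
by rewrite lerXn2r ?nnegrE// ?mulr_ge0 ?enorm_ge0// mulrC dot_CauchySchwarz.
Qed.

Lemma has_ubound_op_norm A :
  has_ubound [set enorm (v *m A^T) | v in [set v | enorm v <= 1]].
Proof.
exists (Num.sqrt (frob A A)) => _ [v /= v1 <-].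
by rewrite (le_trans (enorm_mulmxT_le _ _))// ler_piMr// sqrtr_ge0.
Qed.

Lemma enorm_mulmxT_op_norm v A : enorm (v *m A^T) <= op_norm A * enorm v.
Proof.
have [v0|v0] := eqVneq (enorm v) 0.
  have -> : v = 0.
    apply/rowP => i; rewrite mxE; apply/eqP; rewrite -normr_le0.
    by rewrite (le_trans (le_enorm_coord v i))// v0.
  by rewrite mul0mx !enorm0 mulr0.
have vgt0 : 0 < enorm v by rewrite lt_neqAle eq_sym v0 enorm_ge0.
rewrite -ler_pdivrMr// mulrC -[in X in X * _](ger0_norm (enorm_ge0 v)) -normfV.
rewrite -enormZ scalemxAl; apply: ub_le_sup; first exact: has_ubound_op_norm.
by exists ((enorm v)^-1 *: v) => //=; rewrite enormZ normfV gtr0_norm// mulVf.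
Qed.

Lemma dot_mulmx v w A : dot v (w *m A^T) = dot (v *m A) w.
Proof.
rewrite /dot; under eq_bigr do rewrite mxE mulr_sumr.
rewrite exchange_big; apply: eq_bigr => j _; rewrite mxE mulr_suml.
by apply: eq_bigr => i _; rewrite mxE; ring.
Qed.

(** A matrix and its transpose have the same quadratic form; this is why the
symmetric gradient, and not the full one, controls the relative energy. *)
Lemma quadratic_form_sym v A :
  dot v (v *m A^T) = dot v (v *m (2^-1 *: (A + A^T))^T).
Proof.
rewrite linearZ linearD /= trmxK -scalemxAr dotZr mulmxDr dotDr.
by rewrite [in X in _ + X](dotC v) -dot_mulmx; lra.
Qed.

Lemma quadratic_form_le v A :
  - dot v (v *m A^T) <= op_norm (2^-1 *: (A + A^T)) * enorm v ^+ 2.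
Proof.
rewrite quadratic_form_sym; set S := _ *: _.
rewrite (le_trans (ler_norm _))// normrN (le_trans (dot_CauchySchwarz _ _))//.
by rewrite expr2 mulrA mulrC ler_wpM2r ?enorm_ge0 ?enorm_mulmxT_op_norm.
Qed.

Lemma frob_jac_tensor A v : frob A (tensor v v) = dot v (v *m A^T).
Proof.
rewrite /frob /dot; apply: eq_bigr => i _; rewrite mxE mulr_sumr.
by apply: eq_bigr => j _; rewrite !mxE; ring.
Qed.

End euclidean.

(** * Open sets of space-time are Borel *)

Section borel.
Variables (R : realType) (d : nat).
Local Notation E := ('rV[R]_d * R)%type.

Lemma measurable_rV_ball (c : 'rV[R]_d) (e : R) : measurable (ball c e).
Proof.

have [e0|e0] := leP e 0.
  rewrite (_ : ball c e = set0)//; apply/seteqP; split => // v [].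
  by rewrite ltNge e0.
rewrite (_ : ball c e = \bigcap_(i in [set: 'I_d])
      ((fun v : 'rV[R]_d => v 0 i) @^-1` ball (c 0 i) e)).
  apply: fin_bigcap_measurable => // i _; rewrite -[X in measurable X]setTI.
  by apply: measurable_coord => //; exact: measurable_ball.
apply/seteqP; split => [v [_ cv] i _|v cv]; first exact: cv.
by split => // i j; rewrite ord1; exact: cv.
Qed.

(** Balls with rational centre and radius are a countable base, and in the
sup norm they are boxes. *)
Lemma open_measurable_spacetime (V : set E) : open V -> measurable V.
Proof.
move=> oV.
pose B (q : 'rV[rat]_d * rat * rat) : set E :=
  ball (map_mx ratr q.1.1 : 'rV[R]_d) (ratr q.2) `*` ball (ratr q.1.2 : R) (ratr q.2).
have mB q : measurable (B q).
  by apply: measurableX; [exact: measurable_rV_ball|exact: measurable_ball].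
rewrite (_ : V = \bigcup_(q in [set q | B q `<=` V]) B q).
  rewrite bigcup_mkcond; apply: countable_bigcupT_measurable => //.
  by move=> q; case: ifPn.
apply/seteqP; split => [[x t] Vxt|z [q qV]]; last exact: qV.
have /nbhs_ballP[e /= e0 eV] : nbhs (x, t) V by rewrite nbhsE; exists V.
have [r] : exists r : rat, 0 < (ratr r : R) < e / 2.
  have [|r] := @rat_in_itvoo _ 0 (e / 2); first by rewrite divr_gt0.
  by rewrite in_itv; exists r.
move=> /andP[r0 re].
have approx (y : R) : exists s : rat, `|y - ratr s| < ratr r.
  have [s] : exists s : rat, y < (ratr s : R) < y + ratr r.
    have [|s] := @rat_in_itvoo _ y (y + ratr r); first by rewrite ltrDl.
    by rewrite in_itv; exists s.
  by move=> /andP[ys sy]; exists s; rewrite ltr_norml; apply/andP; split; lra.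
have [s ts] := approx t.
pose c := \row_i projT1 (cid (approx (x 0 i))).
have cP i : `|x 0 i - ratr (c 0 i)| < ratr r.
  by rewrite mxE; exact: projT2 (cid (approx (x 0 i))).
exists (c, s, r); last first.
  split => /=; last by rewrite /ball/= distrC.
  by split => // i j; rewrite ord1 /ball/= mxE distrC.
move=> [y t'] [/= [_ cy] st']; apply: eV; split => /=.
  split => // i j; rewrite ord1 /ball/=.
  have := cy 0 j; rewrite /ball/= mxE => cyj.
  rewrite (le_lt_trans (ler_distD (ratr (c 0 j)) _ _))//.
  have := cP j; lra.
rewrite /ball/= (le_lt_trans (ler_distD (ratr s) _ _))//.
move: st'; rewrite /ball/=; lra.
Qed.

Lemma closed_measurable_spacetime (A : set E) : closed A -> measurable A.
Proof.
by move=> /closed_openC/open_measurable_spacetime/measurableC; rewrite setCK.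
Qed.

Lemma within_continuous_measurable_spacetime (Q : set E) (f : E -> R) :
  measurable Q -> {within Q, continuous f} -> measurable_fun Q f.
Proof.
move=> mQ /continuousP cf; apply: (measurability _ (RGenOpens.measurableE R)).
move=> _ [_ [a [b ->] <-]].
have /open_subspaceP[V oV VQ] : open (f @^-1` `]a, b[ : set (subspace Q)).
  exact/cf/interval_open.
by rewrite setIC -VQ; apply: measurableI => //; exact: open_measurable_spacetime.
Qed.

End borel.

(** * Calculus of test functions *)

Section calculus_rules.
Variables (R : realType) (d : nat) (T : R).
Hypothesis T0 : 0 < T.
Local Notation E := ('rV[R]_d * R)%type.
Implicit Types (f g : E -> R) (z : E) (i : 'I_d).

#[local] Instance dt_nbhs_filter t : Filter (dt_nbhs T t).
Proof. exact: within_filter. Qed.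

(** As T > 0, increments of one sign at least remain available at each time of
[0, T], including the end points, so limits of difference quotients are unique. *)
Lemma dt_nbhs_proper t : 0 <= t <= T -> ProperFilter (dt_nbhs T t).
Proof.
move=> /andP[t0 tT]; apply: Build_ProperFilter_ex => A.
rewrite /dt_nbhs /within /= => /nbhs_ballP[e /= e0 eA].
pose s := Num.min (e / 2) (T / 2).
have s0 : 0 < s by rewrite lt_min !divr_gt0.
have se : s < e by rewrite gt_min; apply/orP; left; lra.
have sT : s <= T / 2 by rewrite ge_min lexx orbT.
have [tle|tgt] := leP t (T / 2).
  (* in the first half of [0, T] one moves forward, in the second backward *)
  exists s; apply: eA; [|by rewrite gt_eqF|by apply/andP; split; lra].
  by rewrite /ball/= sub0r normrN gtr0_norm.
exists (- s); apply: eA; [|by rewrite oppr_eq0 gt_eqF|by apply/andP; split; lra].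
by rewrite /ball/= sub0r opprK gtr0_norm.
Qed.

Lemma dtP f z (l : R) : 0 <= z.2 <= T ->
  dt_quotient f z @ dt_nbhs T z.2 --> l -> dt_derivable T f z /\ dt T f z = l.
Proof.
move=> zT fl; have := dt_nbhs_proper zT => ?.
by split; [apply/cvg_ex; exists l|exact: cvg_lim fl].
Qed.

Lemma near_dt_nbhs (t : R) (A : set R) :
  (\forall s \near t, 0 <= s <= T -> A s) -> \forall h \near dt_nbhs T t, A (t + h).
Proof.
move=> /nbhs_ballP[e /= e0 eA].
rewrite /dt_nbhs /within; apply/nbhs_ballP; exists e => //= h eh _ th.
by apply: eA => //; move: eh; rewrite /ball/= sub0r normrN opprD addNKr normrN.
Qed.

(** Differentiability in time gives continuity in time: the increment is h times
a convergent difference quotient. *)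
Lemma dt_shift_cvg f z : 0 <= z.2 <= T -> dt_derivable T f z ->
  (fun h => f (z.1, z.2 + h)) @ dt_nbhs T z.2 --> f z.
Proof.
move=> zT df; have := dt_nbhs_proper zT => ?.
have h0 : (fun h : R => h) @ dt_nbhs T z.2 --> 0.
  by move=> A /nbhs_dnbhs; apply: filterS => h Ah _.
have := cvgD (cvgM h0 df) (@cvg_cst _ (f z) _ (dt_nbhs T z.2) _).
rewrite mul0r add0r => H.
apply: (cvg_trans _ (H _ _ _)).
apply: near_eq_cvg.
apply: filterS (nbhs_dnbhs_neq (0 : R)) => h hneq0 _.
transitivity (h * dt_quotient f z h + f z) => //.
by rewrite /dt_quotient mulrA mulfV ?mul1r ?subrK.
Qed.

Lemma dt_cst (c : R) z : 0 <= z.2 <= T ->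
  dt_derivable T (fun=> c) z /\ dt T (fun=> c) z = 0.
Proof.
move=> zT; apply: dtP => //; have := dt_nbhs_proper zT => ?.
rewrite (_ : dt_quotient _ _ = fun=> 0); first exact: cvg_cst.
by apply/funext => h; rewrite /dt_quotient subrr mulr0.
Qed.

Lemma dtD f g z : 0 <= z.2 <= T -> dt_derivable T f z -> dt_derivable T g z ->
  dt_derivable T (fun z => f z + g z) z /\
  dt T (fun z => f z + g z) z = dt T f z + dt T g z.
Proof.
move=> zT df dg; apply: dtP => //; have := dt_nbhs_proper zT => ?.
rewrite (_ : dt_quotient _ _ = fun h => dt_quotient f z h + dt_quotient g z h).
  exact: (cvgD df dg).
by apply/funext => h; rewrite /dt_quotient -mulrDr; congr (_ * _); ring.
Qed.

Lemma dtM f g z : 0 <= z.2 <= T -> dt_derivable T f z -> dt_derivable T g z ->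
  dt_derivable T (fun z => f z * g z) z /\
  dt T (fun z => f z * g z) z = dt T f z * g z + f z * dt T g z.
Proof.
move=> zT df dg; apply: dtP => //; have := dt_nbhs_proper zT => ?.
rewrite (_ : dt_quotient _ _ = fun h =>
    dt_quotient f z h * g (z.1, z.2 + h) + f z * dt_quotient g z h).
  apply: cvgD; first exact: cvgM df (dt_shift_cvg zT dg).
  by apply: cvgM; [exact: cvg_cst|exact: dg].
by apply/funext => h; rewrite /dt_quotient; ring.
Qed.

Lemma near_eq_dt f g z : 0 <= z.2 <= T -> (\forall y \near z, f y = g y) ->
  dt_derivable T f z -> dt_derivable T g z /\ dt T g z = dt T f z.
Proof.
move=> zT fg df; apply: dtP => //; apply: cvg_trans df.
apply: near_eq_cvg.
have fgz : f z = g z by exact: nbhs_singleton fg.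
have : \forall h \near dt_nbhs T z.2, f (z.1, z.2 + h) = g (z.1, z.2 + h).
  apply: (@near_dt_nbhs z.2 (fun s => f (z.1, s) = g (z.1, s))).
  have /nbhs_ballP[e /= e0 eA] := fg.
  apply/nbhs_ballP; exists e => //= s ts _; apply: eA.
  by split => //=; exact: ballxx.
by apply: filterS => h; rewrite /dt_quotient fgz => ->.
Qed.

Lemma dxM i f g z : dx_derivable i f z -> dx_derivable i g z ->
  dx_derivable i (fun z => f z * g z) z /\
  dx i (fun z => f z * g z) z = dx i f z * g z + f z * dx i g z.
Proof.
rewrite /dx_derivable /dx => df dg; split; first exact: (derivableM df dg).
transitivity (f z *: 'D_(dx_dir R i) g z + g z *: 'D_(dx_dir R i) f z).
  exact: (deriveM df dg).
by rewrite addrC; congr (_ + _); rewrite /GRing.scale/= mulrC.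
Qed.

Lemma dxD i f g z : dx_derivable i f z -> dx_derivable i g z ->
  dx_derivable i (fun z => f z + g z) z /\
  dx i (fun z => f z + g z) z = dx i f z + dx i g z.
Proof.
rewrite /dx_derivable /dx => df dg.
by split; [exact: (derivableD df dg)|exact: (deriveD df dg)].
Qed.

Lemma dx_cst i (c : R) z : dx_derivable i (fun=> c) z /\ dx i (fun=> c) z = 0.
Proof. by split; [exact: derivable_cst|exact: derive_cst]. Qed.

Lemma tsupportM f g : tsupport (fun z => f z * g z) `<=` tsupport f.
Proof. by apply: closure_subset => z /=; rewrite mulf_eq0 negb_or => /andP[]. Qed.

Section C1_algebra.
Variable Q : set E.
Hypothesis QT : forall z, Q z -> 0 <= z.2 <= T.

Lemma C1_on_cst (c : R) : C1_on T Q (fun=> c).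
Proof.
have cQ a : {within Q, continuous (fun _ : E => a : R)}.
  by apply: continuous_subspaceT => ?; exact: cvg_cst.
split => // [|i]; split.
- by move=> z Qz; have [] := dt_cst c (QT Qz).
- apply: (@subspace_eq_continuous _ _ _ (fun=> 0)) (cQ 0) => z /set_mem Qz.
  by have [_ /esym] := dt_cst c (QT Qz).
- by move=> z _; have [] := dx_cst i c z.
- apply: (@subspace_eq_continuous _ _ _ (fun=> 0)) (cQ 0) => z _.
  by have [_ /esym] := dx_cst i c z.
Qed.

Lemma C1_onD f g : C1_on T Q f -> C1_on T Q g -> C1_on T Q (fun z => f z + g z).
Proof.
move=> [cf [tf ctf] xf] [cg [tg ctg] xg].
split; first by move=> z; exact: continuousD (cf z) (cg z).
  split; first by move=> z Qz; have [] := dtD (QT Qz) (tf _ Qz) (tg _ Qz).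
  apply: (@subspace_eq_continuous _ _ _ (fun z => dt T f z + dt T g z)).
    by move=> z /set_mem Qz; have [_ /esym] := dtD (QT Qz) (tf _ Qz) (tg _ Qz).
  by move=> z; exact: continuousD (ctf z) (ctg z).
move=> i; have [{}xf cxf] := xf i; have [{}xg cxg] := xg i; split.
  by move=> z Qz; have [] := dxD (xf _ Qz) (xg _ Qz).
apply: (@subspace_eq_continuous _ _ _ (fun z => dx i f z + dx i g z)).
  by move=> z /set_mem Qz; have [_ /esym] := dxD (xf _ Qz) (xg _ Qz).
by move=> z; exact: continuousD (cxf z) (cxg z).
Qed.

Lemma C1_onM f g : C1_on T Q f -> C1_on T Q g -> C1_on T Q (fun z => f z * g z).
Proof.
move=> [cf [tf ctf] xf] [cg [tg ctg] xg].
split; first by move=> z; exact: continuousM (cf z) (cg z).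
  split; first by move=> z Qz; have [] := dtM (QT Qz) (tf _ Qz) (tg _ Qz).
  apply: (@subspace_eq_continuous _ _ _
      (fun z => dt T f z * g z + f z * dt T g z)).
    by move=> z /set_mem Qz; have [_ /esym] := dtM (QT Qz) (tf _ Qz) (tg _ Qz).
  move=> z; exact: continuousD (continuousM (ctf z) (cg z))
    (continuousM (cf z) (ctg z)).
move=> i; have [{}xf cxf] := xf i; have [{}xg cxg] := xg i; split.
  by move=> z Qz; have [] := dxM (xf _ Qz) (xg _ Qz).
apply: (@subspace_eq_continuous _ _ _ (fun z => dx i f z * g z + f z * dx i g z)).
  by move=> z /set_mem Qz; have [_ /esym] := dxM (xf _ Qz) (xg _ Qz).
move=> z; exact: continuousD (continuousM (cxf z) (cg z))
  (continuousM (cf z) (cxg z)).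
Qed.

Lemma C1_on_sum (I : Type) (r : seq I) (F : I -> E -> R) :
  (forall j, C1_on T Q (F j)) -> C1_on T Q (fun z => \sum_(j <- r) F j z) /\
  forall z, Q z ->
    dt T (fun z => \sum_(j <- r) F j z) z = \sum_(j <- r) dt T (F j) z /\
    forall i, dx i (fun z => \sum_(j <- r) F j z) z = \sum_(j <- r) dx i (F j) z.
Proof.
move=> CF; elim: r => [|j r [IH1 IH2]].
  under eq_fun do rewrite big_nil; split; first exact: C1_on_cst.
  move=> z Qz; have [_ ->] := dt_cst 0 (QT Qz); rewrite big_nil; split => // i.
  by have [_ ->] := dx_cst i 0 z; rewrite big_nil.
under eq_fun do rewrite big_cons; split; first exact: C1_onD.
move=> z Qz; have [_ [tj _] xj] := CF j; have [_ [tr _] xr] := IH1.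
have [_ ->] := dtD (QT Qz) (tj _ Qz) (tr _ Qz).
have [-> xs] := IH2 _ Qz; rewrite big_cons; split => // i.
by have [_ ->] := dxD ((xj i).1 _ Qz) ((xr i).1 _ Qz); rewrite xs big_cons.
Qed.

Lemma C1_dtM f g z : C1_on T Q f -> C1_on T Q g -> Q z ->
  dt T (fun z => f z * g z) z = dt T f z * g z + f z * dt T g z.
Proof.
by move=> [_ [tf _] _] [_ [tg _] _] Qz; have [] := dtM (QT Qz) (tf _ Qz) (tg _ Qz).
Qed.

Lemma C1_dxM i f g z : C1_on T Q f -> C1_on T Q g -> Q z ->
  dx i (fun z => f z * g z) z = dx i f z * g z + f z * dx i g z.
Proof.
move=> [_ _ xf] [_ _ xg] Qz.
by have [] := dxM ((xf i).1 _ Qz) ((xg i).1 _ Qz).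
Qed.

Lemma C1_compactM f g : C1_compact T Q f -> C1_on T Q g ->
  C1_compact T Q (fun z => f z * g z).
Proof.
move=> [Cf kf fQ] Cg.
have sub := @tsupportM f g.
split; [exact: C1_onM| |exact: subset_trans fQ].
by apply: subclosed_compact kf sub; exact: closed_closure.
Qed.

End C1_algebra.

(** The complement of the support is open, so that a function vanishes, together
with its derivatives, in a neighbourhood of each point outside its support. *)
Lemma near_tsupport f z : ~ tsupport f z -> \forall y \near z, f y = 0.
Proof.
have : closed (tsupport f) by exact: closed_closure.
move=> /closed_openC oC zf.
have : nbhs z (~` tsupport f) by exact: open_nbhs_nbhs.
apply: filterS => y yf; apply/eqP; apply/negP => /negP fy.
by apply: yf; exact: subset_closure.
Qed.

Lemma dx_tsupport i f z : ~ tsupport f z -> dx_derivable i f z /\ dx i f z = 0.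
Proof.
move=> /near_tsupport f0; have [d0 <-] := dx_cst i 0 z; split.
  by apply: near_eq_derivable d0; apply: filterS f0.
exact: near_eq_derive.
Qed.

Lemma dt_tsupport f z : 0 <= z.2 <= T -> ~ tsupport f z ->
  dt_derivable T f z /\ dt T f z = 0.
Proof.
move=> zT /near_tsupport f0; have [d0 <-] := dt_cst 0 zT.
by apply: near_eq_dt => //; apply: filterS f0.
Qed.

End calculus_rules.

(** * Relatively open sets and extension by zero *)

Section relatively_open.
Variables (R : realType) (d : nat) (Omega : set 'rV[R]_d) (T : R).
Hypotheses (oOmega : open Omega) (T0 : 0 < T).
Local Notation E := ('rV[R]_d * R)%type.
Local Notation cyl := (cylinder Omega T).
Variable Q : set E.
Hypothesis oQ : rel_open Omega T Q.

Lemma rel_open_cylinder : Q `<=` cyl.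
Proof. by case: oQ => V _ -> z []. Qed.

Lemma rel_open_time z : Q z -> 0 <= z.2 <= T.
Proof. by move=> /rel_open_cylinder[]. Qed.

Lemma rel_open_nbhs z : Q z -> \forall y \near z, cyl y -> Q y.
Proof.
case: oQ => V oV -> [Vz _]; have : nbhs z V by exact: open_nbhs_nbhs.
by apply: filterS => y Vy cy; split.
Qed.

Lemma measurable_cylinder : measurable cyl.
Proof.
rewrite (_ : cyl = (Omega `*` setT) `&` (setT `*` `[0, T])); last first.
  apply/seteqP; split => z; rewrite /cylinder/= in_itv/=; first by case.
  by case=> -[? _] [_ ?].
apply: measurableI.
  apply: open_measurable_spacetime.
  rewrite (_ : _ `*` _ = fst @^-1` Omega); last first.
    by apply/seteqP; split => z /=; [case|].
  by apply: open_comp => // z _; exact: cvg_fst.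
by apply: measurableX.
Qed.

Lemma measurable_rel_open : measurable Q.
Proof.
case: oQ => V oV ->; apply: measurableI; last exact: measurable_cylinder.
exact: open_measurable_spacetime.
Qed.

(** Extension by zero preserves continuity: near a point of Q the sets Q and
Omega x [0, T] coincide, and the other points have a neighbourhood that misses
the closed set K. *)
Lemma within_continuous_cylinder (f : E -> R) (K : set E) :
  closed K -> K `<=` Q -> {within Q, continuous f} ->
  (forall z, cyl z -> ~ K z -> f z = 0) -> {within cyl, continuous f}.
Proof.
move=> cK KQ cf f0; apply/subspace_continuousP => z cz.
have [Qz|nQz] := pselect (Q z).
  move/subspace_continuousP : cf => /(_ _ Qz); apply: cvg_trans.
  move=> A; rewrite /= /within /= !nbhs_simpl /= => h.
  by have := rel_open_nbhs Qz; apply: filterS2 h => y hy /[swap] cy /(_ cy)/hy.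
have nKz : ~ K z by move=> /KQ.
have fz : f z = 0 by exact: f0.
move=> A Az; have A0 : A 0 by rewrite -fz; exact: nbhs_singleton Az.
have : nbhs z (~` K) by apply: open_nbhs_nbhs; split => //; exact: closed_openC.
by apply: filterS => y nKy cy; change (A (f y)); rewrite f0.
Qed.

Lemma C1_compact_on_cylinder f : C1_compact T Q f -> C1_on T cyl f.
Proof.
move=> [[cf [tf ctf] xf] _ fQ].
have ck : closed (tsupport f) by exact: closed_closure.
split.
- apply: (within_continuous_cylinder ck fQ cf) => z cz nz.
  exact: nbhs_singleton (near_tsupport nz).
- split.
    move=> z cz; have [/fQ/tf//|nz] := pselect (tsupport f z).
    by have [] := dt_tsupport T0 cz.2 nz.
  apply: (within_continuous_cylinder ck fQ ctf) => z cz nz.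
  by have [] := dt_tsupport T0 cz.2 nz.
- move=> i; have [{}xf cxf] := xf i; split.
    move=> z cz; have [/fQ/xf//|nz] := pselect (tsupport f z).
    by have [] := dx_tsupport i nz.
  apply: (within_continuous_cylinder ck fQ cxf) => z cz nz.
  by have [] := dx_tsupport i nz.
Qed.

Lemma C1_on_subset f : C1_on T cyl f -> C1_on T Q f.
Proof.
have Qc := rel_open_cylinder.
move=> [cf [tf ctf] xf]; split; first exact: continuous_subspaceW cf.
  by split; [move=> z /Qc/tf|exact: continuous_subspaceW ctf].
move=> i; have [{}xf cxf] := xf i.
by split; [move=> z /Qc/xf|exact: continuous_subspaceW cxf].
Qed.

(** Along a vertical segment the one-sided time derivative is an ordinary
derivative in the interior, so the fundamental theorem of calculus applies. *)
Lemma FTC_dt f x (tau : R) : C1_on T cyl f -> Omega x -> 0 < tau <= T ->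
  (\int[lebesgue_measure]_(t in `[0%R, tau]) (dt T f (x, t))%:E
   = (f (x, tau))%:E - (f (x, 0))%:E)%E.
Proof.
move=> [cf [tf ctf] _] Ox /andP[tau0 tauT].
have slice (g : E -> R) : {within cyl, continuous g} ->
    {within `[0, tau], continuous (fun t => g (x, t))}.
  move=> /subspace_continuousP cg; apply/subspace_continuousP => t /=.
  rewrite in_itv/= => /andP[t0 tt].
  have cxt : cyl (x, t) by split => //=; rewrite t0 (le_trans tt).
  move=> A /(cg _ cxt); rewrite /= /within /= => /nbhs_ballP[e /= e0 eA].
  apply/nbhs_ballP; exists e => //= s ts; rewrite in_itv/= => /andP[s0 st].
  apply: eA; first by split => //=; exact: ballxx.
  by split => //=; rewrite s0 (le_trans st).
have inner t : t \in `]0, tau[ ->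
    derivable (fun t => f (x, t)) t 1 /\ derive1 (fun t => f (x, t)) t = dt T f (x, t).
  rewrite in_itv/= => /andP[t0 tt].
  have tT : 0 <= t <= T by rewrite ltW//= (le_trans (ltW tt)).
  have cxt : cyl (x, t) by split.
  have : (fun h => h^-1 *: (f (x, h *: 1 + t) - f (x, t))) @ 0^' -->
      dt T f (x, t).
    apply: (cvg_trans _ (tf _ cxt)).
    move=> A; rewrite /= /dt_nbhs /within /= => h.
    have near0 : \forall s \near (0 : R)^', 0 <= t + s <= T.
      apply: nbhs_dnbhs; apply/nbhs_ballP; exists (Num.min t (T - t)) => /=.
        by rewrite lt_min t0 subr_gt0 (lt_le_trans tt).
      move=> s; rewrite /ball/= sub0r normrN lt_min => /andP[].
      by rewrite !ltr_norml => /andP[? ?] /andP[? ?]; apply/andP; split; lra.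
    have h' : \forall s \near (0 : R)^',
      0 <= t + s <= T -> A (dt_quotient f (x, t) s) by exact: h.
    change (\forall s \near (0 : R)^',
      A (s^-1 *: (f (x, s *: 1 + t) - f (x, t)))).
    apply: filterS2 h' near0 => s hs /hs.
    by rewrite /dt_quotient /GRing.scale /= mulr1 (addrC s).
  move=> c; split; first by apply/cvg_ex; exists (dt T f (x, t)).
  by rewrite derive1E; apply: cvg_lim c.
have ct0 : {within `[0, tau], continuous (fun t => f (x, t))} by exact: slice.
apply: (@continuous_FTC2 _ _ (fun t => f (x, t))) => //.
- exact: slice.
- have [_ l r] := (continuous_within_itvP _ tau0).1 ct0.
  by split => // t /inner[].
- by move=> t /inner[].
Qed.

(** Continuity on the whole space, not merely on Omega: K lies over Omega, so a
point x outside Omega has a neighbourhood on which the slice vanishes. *)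
Lemma slice_space_continuous (f : E -> R) (K : set E) (t : R) :
  closed K -> K `<=` Q -> {within cyl, continuous f} ->
  (forall z, ~ K z -> f z = 0) -> 0 <= t <= T ->
  continuous (fun x => f (x, t)).
Proof.
move=> clK KQ /subspace_continuousP cf f0 tT x.
have [Ox|nOx] := pselect (Omega x).
  have cxt : cyl (x, t) by [].
  move=> A /(cf _ cxt); rewrite /= /within /= => /nbhs_ballP[e /= e0 eA].
  have : nbhs x Omega by exact: open_nbhs_nbhs.
  move=> /nbhs_ballP[r /= r0 rO].
  apply/nbhs_ballP; exists (Num.min e r) => /=; first by rewrite lt_min e0.
  move=> y xy; apply: eA.
    by split => /=; [apply: le_ball xy; rewrite ge_min lexx|exact: ballxx].
  by split => //=; apply/rO; apply: le_ball xy; rewrite ge_min lexx orbT.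
have nz : ~ K (x, t) by move=> /KQ/rel_open_cylinder[].
have : nbhs (x, t) (~` K).
  by apply: open_nbhs_nbhs; split => //; exact: closed_openC.
move=> /nbhs_ballP[e /= e0 eA].
move=> A Az; have A0 : A 0 by rewrite -(f0 _ nz); exact: nbhs_singleton Az.
apply/nbhs_ballP; exists e => //= y xy; change (A (f (y, t))); rewrite f0//.
by apply: eA; split => //=; exact: ballxx.
Qed.

Lemma dx_slice i f (x : 'rV[R]_d) (t : R) :
  (dx_derivable i f (x, t) <-> derivable (fun x => f (x, t)) x (delta_mx 0 i)) /\
  dx i f (x, t) = 'D_(delta_mx 0 i) (fun x => f (x, t)) x.
Proof.
rewrite /dx_derivable /derivable /dx /derive /=.
have -> : (fun h : R => h^-1 *: (f (h *: dx_dir R i + (x, t)) - f (x, t))) =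
    (fun h : R => h^-1 *: (f (h *: delta_mx 0 i + x, t) - f (x, t))).
  apply/funext => h; congr (_ *: (f _ - _)).
  by congr pair; rewrite /= scaler0 add0r.
by [].
Qed.

End relatively_open.

(** * Partial derivatives of compactly supported functions integrate to zero *)

Section integration_by_parts.
Variable R : realType.
Local Notation lam := (@lebesgue_measure R).
Local Open Scope ring_scope.

Definition box n (r : R) : set 'rV[R]_n := [set x | forall j, - r <= x 0 j <= r].

Lemma compact_box n r : compact (@box n r).
Proof.
rewrite (_ : box _ = [set v : 'rV[R]_n | forall i, `[- r, r]%classic (v ord0 i)]).
  apply: (@rV_compact R n (fun=> `[- r, r]%classic)) => i.
  exact: segment_compact.
by apply/seteqP; split => v /= vr j; have := vr j; rewrite /= in_itv.
Qed.

Lemma measurable_box n r : measurable (@box n r).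
Proof.
rewrite (_ : box _ = \bigcap_(i in [set: 'I_n])
    ((fun v : 'rV[R]_n => v 0 i) @^-1` `[- r, r])).
  apply: fin_bigcap_measurable => // i _; rewrite -[X in measurable X]setTI.
  exact: measurable_coord.
apply/seteqP; split => v /= vr i.
  by move=> _; have := vr i; rewrite /= in_itv.
by have := vr i I; rewrite /= in_itv.
Qed.

Lemma lebesgue_box_lty n r : (lebesgue_rV R n (box r) < +oo)%E.
Proof.
rewrite (_ : box r = [set v : 'rV[R]_n | forall i, `[- r, r]%classic (v 0 i)]).
  rewrite (@lebesgue_rV_box R n (fun=> `[- r, r]%classic)) => [|i //].
  rewrite (_ : lam `[- r, r] = (fine (lam `[- r, r]))%:E).
    by rewrite prodEFin ltry.
  by rewrite fineK// lebesgue_measure_itv/=; case: ifP.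
by apply/seteqP; split => v /= vr j; have := vr j; rewrite /= in_itv.
Qed.

Lemma continuous_measurable_rV n (f : 'rV[R]_n -> R) :
  continuous f -> measurable_fun setT f.
Proof.
move=> cf.
have mf : measurable_fun setT (fun z : 'rV[R]_n * R => f z.1).
  apply: within_continuous_measurable_spacetime => //.
  apply: continuous_subspaceT => z; apply: continuous_comp; first exact: cvg_fst.
  exact: cf.
apply: (measurableT_comp mf (f := fun z => f z.1) (g := fun x => (x, 0 : R))).
exact: measurable_fun_pair.
Qed.

Lemma integrable_continuous_box n (f : 'rV[R]_n -> R) r : continuous f ->
  (forall x, ~ box r x -> f x = 0) ->
  (lebesgue_rV R n).-integrable setT (EFin \o f).
Proof.
move=> cf f0; have mf := continuous_measurable_rV cf.
have : (lebesgue_rV R n).-integrable (box r) (EFin \o f).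
  apply: measurable_bounded_integrable.
  - exact: measurable_box.
  - exact: lebesgue_box_lty.
  - exact: measurable_funS mf.
  - have : compact (f @` box r).
      by apply: continuous_compact (@compact_box n r); exact: continuous_subspaceT.
    move=> /compact_bounded[M [Mr fM]]; exists M; split => // y yM x bx.
    by apply: fM => //; exists x.
move=> /(integrable_mkcond _ (@measurable_box n r)).
apply: eq_integrable => // x _; rewrite patchE; case: ifPn => //.
by rewrite notin_setE => /f0 /= ->.
Qed.

Lemma integral_derive1_box (g : R -> R) r : 0 < r ->
  (forall t, derivable g t 1) -> continuous (derive1 g) ->
  (forall t, ~ (- r <= t <= r) -> g t = 0) ->
  (\int[lam]_t (derive1 g t)%:E = 0)%E.
Proof.
move=> r0 dg cg g0.
have near0 t : ~ (- r <= t <= r) -> derive1 g t = 0.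
  move=> tr; have cr : closed `[- r, r]%classic by exact: interval_closed.
  have : nbhs t (~` `[- r, r]%classic).
    apply: open_nbhs_nbhs; split; first exact: closed_openC.
    by rewrite /= in_itv.
  move=> nt; rewrite derive1E -(derive_cst (0 : R) (t : R) 1).
  by apply: near_eq_derive; apply: filterS nt => s; rewrite /= in_itv => /g0.
(* strictly larger than r, so that g vanishes at the end points - b and b *)
pose b := r + 1.
rewrite (_ : (fun t => _) = (EFin \o derive1 g) \_ `[- b, b]); last first.
  apply/funext => t; rewrite patchE; case: ifPn => //; rewrite notin_setE/= in_itv/=.
  move=> tb; rewrite near0// => /andP[? ?]; apply: tb; rewrite /b.
  by apply/andP; split; lra.
rewrite -integral_mkcond /=.
have ctg t : {for t, continuous g}.
  by apply: differentiable_continuous; rewrite -derivable1_diffP.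
rewrite (@continuous_FTC2 _ _ g).
- by rewrite !g0 ?subee// /b => /andP[? ?]; lra.
- by rewrite /b; lra.
- exact: continuous_subspaceT.
- split => [t _//||]; [apply: cvg_at_right_filter|apply: cvg_at_left_filter];
    exact: ctg.
- by [].
Qed.

Lemma cons_rV_ball n (p q : R * 'rV[R]_n) e :
  ball p e q -> ball (cons_rV p) e (cons_rV q).
Proof.
move=> [p1 [e0 p2]]; split => // i j; rewrite ord1.
case: (unliftP 0 j) => [k|] ->; first by rewrite !cons_rVr; exact: p2.
by rewrite !cons_rVl.
Qed.

Lemma cons_rV_delta0 n (h x : R) (v : 'rV[R]_n) :
  h *: delta_mx 0 0 + cons_rV (x, v) = cons_rV (h + x, v).
Proof.
apply/rowP => j; rewrite [LHS]mxE [X in X + _]mxE [X in _ * X]mxE.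
case: (unliftP 0 j) => [k|] ->; first by rewrite !cons_rVr /= mulr0 add0r.
by rewrite !cons_rVl /= mulr1.
Qed.

Lemma cons_rV_delta_lift n (h x : R) (v : 'rV[R]_n) (k : 'I_n) :
  h *: delta_mx 0 (lift 0 k) + cons_rV (x, v) =
  cons_rV (x, h *: delta_mx 0 k + v).
Proof.
apply/rowP => j; rewrite [LHS]mxE [X in X + _]mxE [X in _ * X]mxE.
case: (unliftP 0 j) => [l|] ->; last by rewrite !cons_rVl /= mulr0 add0r.
by rewrite !cons_rVr /= !mxE/= (inj_eq lift_inj).
Qed.

Lemma lebesgue_rVS n : lebesgue_rV R n.+1 =
  pushforward (lam \x lebesgue_rV R n)%E (@cons_rV R n) :> (set _ -> \bar R).
Proof. by []. Qed.

(** The carrier of the Lebesgue measure is R with the sigma-algebra generated by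
half-open intervals; the product measure refers to that copy of R. *)
Lemma measurable_cons_lam n :
  measurable_fun [set: (measurableTypeR R * 'rV[R]_n)%type] (@cons_rV R n).
Proof. exact: measurable_cons_rV. Qed.

Lemma integral_lebesgue_cons n (f : 'rV[R]_n.+1 -> R) :
  measurable_fun setT f ->
  ((lam \x lebesgue_rV R n)%E).-integrable setT (fun p => (f (cons_rV p))%:E) ->
  (\int[lebesgue_rV R n.+1]_x (f x)%:E
   = \int[(lam \x lebesgue_rV R n)%E]_p (f (cons_rV p))%:E)%E.
Proof.
move=> mf intf; rewrite lebesgue_rVS.
rewrite (integral_pushforward (@measurable_cons_lam n)) ?preimage_setT//.
by apply/measurable_EFinP.
Qed.
Lemma integrable_lebesgue_cons n (f : 'rV[R]_n.+1 -> R) :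
  measurable_fun setT f -> (lebesgue_rV R n.+1).-integrable setT (EFin \o f) ->
  ((lam \x lebesgue_rV R n)%E).-integrable setT (fun p => (f (cons_rV p))%:E).
Proof.
move=> mf /integrableP[_ foo]; apply/integrableP; split.
  apply/measurable_EFinP; apply: measurableT_comp => //.
  exact: measurable_cons_lam.
move: foo; rewrite lebesgue_rVS ge0_integral_pushforward//.
- exact: measurable_cons_lam.
- by apply: measurableT_comp => //; exact/measurable_EFinP.
Qed.

(** By induction on the dimension: Fubini reduces the claim either to the
first coordinate, where it is the fundamental theorem of calculus on a line, or
to a derivative along a slice of lower dimension. *)
Lemma integral_derive_box n (h : 'rV[R]_n -> R) (i : 'I_n) r : 0 < r ->
  (forall x, derivable h x (delta_mx 0 i)) ->
  continuous ('D_(delta_mx 0 i) h) ->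
  (forall x, ~ box r x -> h x = 0) ->
  (forall x, ~ box r x -> 'D_(delta_mx 0 i) h x = 0) ->
  (\int[lebesgue_rV R n]_x ('D_(delta_mx 0 i) h x)%:E = 0)%E.
Proof.
elim: n => [|n IH] in h i * => r0 dh cdh h0 dh0; first by case: i {dh cdh dh0}.
have mdh := continuous_measurable_rV cdh.
have intdh := integrable_lebesgue_cons mdh (integrable_continuous_box cdh dh0).
have boxl x v : box r (cons_rV (x, v)) -> - r <= x <= r.
  by move=> /(_ 0); rewrite cons_rVl.
have boxr x v : box r (@cons_rV R n (x, v)) -> box r v.
  by move=> b j; have := b (lift 0 j); rewrite cons_rVr.
rewrite integral_lebesgue_cons//.
have cl v : continuous (fun x => @cons_rV R n (x, v)).
  move=> x A /nbhs_ballP[e /= e0 eA]; apply/nbhs_ballP; exists e => //= y xy.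
  by apply: eA; apply: cons_rV_ball; split => //=; exact: ballxx.
have cr x : continuous (fun v => @cons_rV R n (x, v)).
  move=> v A /nbhs_ballP[e /= e0 eA]; apply/nbhs_ballP; exists e => //= y xy.
  by apply: eA; apply: cons_rV_ball; split => //=; exact: ballxx.
case: (unliftP 0 i) => [k|] iE; subst i.
  rewrite -integral12_prod_meas1//; apply: integral0_eq => x _.
  have dE v : (derivable (fun v => h (cons_rV (x, v))) v (delta_mx 0 k) <->
       derivable h (cons_rV (x, v)) (delta_mx 0 (lift 0 k))) /\
      'D_(delta_mx 0 k) (fun v => h (cons_rV (x, v))) v =
      'D_(delta_mx 0 (lift 0 k)) h (cons_rV (x, v)).
    rewrite /derivable /derive /=.
    have -> // : (fun a : R => a^-1 *: (h (a *: delta_mx 0 (lift 0 k) +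
        cons_rV (x, v)) - h (cons_rV (x, v)))) = (fun a : R =>
        a^-1 *: (h (cons_rV (x, a *: delta_mx 0 k + v)) - h (cons_rV (x, v)))).
    by apply/funext => a; rewrite cons_rV_delta_lift.
  rewrite /fubini_F; under eq_integral do rewrite -(dE _).2.
  apply: IH => // [v|v|v vr|v vr].
  - by apply/(dE v).1; exact: dh.
  - rewrite (_ : 'D_(delta_mx 0 k) _ =
      fun v => 'D_(delta_mx 0 (lift 0 k)) h (cons_rV (x, v))).
      exact: (@continuous_comp _ _ _ (fun v => cons_rV (x, v)) _ v (cr x v) (cdh _)).
    by apply/funext => w; rewrite (dE w).2.
  - by apply: h0 => /boxr.
  - by rewrite (dE v).2; apply: dh0 => /boxr.
rewrite -integral21_prod_meas1//; apply: integral0_eq => v _.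
have dE x : (derivable (fun x => h (cons_rV (x, v))) x 1 <->
     derivable h (cons_rV (x, v)) (delta_mx 0 0)) /\
    derive1 (fun x => h (cons_rV (x, v))) x =
    'D_(delta_mx 0 0) h (cons_rV (x, v)).
  rewrite derive1E /derivable /derive /=.
  have -> : (fun a : R => a^-1 *: (h (a *: delta_mx 0 0 +
      cons_rV (x, v)) - h (cons_rV (x, v)))) = (fun a : R =>
      a^-1 *: (h (cons_rV (a + x, v)) - h (cons_rV (x, v)))).
    by apply/funext => a; rewrite cons_rV_delta0.
  have -> // : (fun a : R => a^-1 *: (h (cons_rV (a *: 1 + x, v)) -
      h (cons_rV (x, v)))) = (fun a : R =>
      a^-1 *: (h (cons_rV (a + x, v)) - h (cons_rV (x, v)))).
  by apply/funext => a; rewrite [a *: 1]mulr1.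
rewrite /fubini_G; under eq_integral do rewrite -(dE _).2.
apply: (@integral_derive1_box _ r) => // [x||x xr].
- by apply/(dE x).1; exact: dh.
- rewrite (_ : derive1 _ = fun x => 'D_(delta_mx 0 0) h (cons_rV (x, v))).
    move=> x.
    exact: (@continuous_comp _ _ _ (fun x => cons_rV (x, v)) _ x (cl v x) (cdh _)).
  by apply/funext => w; rewrite (dE w).2.
- by apply: h0 => /boxl.
Qed.

End integration_by_parts.

(** * Integrability of cubic expressions in the velocity *)

Section growth.
Variables (R : realType) (d : nat) (Omega : set 'rV[R]_d) (T : R).
Hypotheses (oOmega : open Omega) (T0 : 0 < T).
Local Notation E := ('rV[R]_d * R)%type.
Local Notation lam := (@lebesgue_measure R).
Local Notation leb := (lebesgue_rV R d).
Local Notation mu := (leb \x lam)%E.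
Local Notation cyl := (cylinder Omega T).
Variables (Q K : set E) (u : E -> 'rV[R]_d) (p : E -> R).
Hypotheses (oQ : rel_open Omega T Q) (kK : compact K) (clK : closed K) (KQ : K `<=` Q).
Hypotheses (uL3 : L3_loc Q u) (pL32 : L32_loc Q p).

Let mQ : measurable Q. Proof. exact: measurable_rel_open oQ. Qed.
Let mK : measurable K. Proof. exact: closed_measurable_spacetime. Qed.

Local Notation Emu := ('rV[R]_d * measurableTypeR R)%type.
Let mKmu : measurable (K : set Emu). Proof. exact: mK. Qed.

(** Assigns degree one to u and degree two to p; the constant 1 makes lower degrees
weaker. *)
Definition weight (z : E) : R := 1 + enorm (u z) + Num.sqrt `|p z|.

(** Polynomial degree in the velocity (degree one) and the pressure (degree two),
with coefficients bounded on K. Degrees add under multiplication, so integrability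
of a flux is settled by counting its factors. *)
Definition growth (k : nat) (g : E -> R) : Prop :=
  measurable_fun Q g /\
  exists2 C, 0 <= C & forall z, K z -> `|g z| <= C * weight z ^+ k.

Lemma weight_ge1 z : 1 <= weight z.
Proof. by rewrite /weight -addrA lerDl addr_ge0 ?enorm_ge0 ?sqrtr_ge0. Qed.

Lemma growthW k l g : (k <= l)%N -> growth k g -> growth l g.
Proof.
move=> kl [mg [C C0 gC]]; split => //; exists C => // z Kz.
by rewrite (le_trans (gC _ Kz))// ler_wpM2l// ler_weXn2l ?weight_ge1.
Qed.

Lemma growthD k f g : growth k f -> growth k g -> growth k (fun z => f z + g z).
Proof.
move=> [mf [C C0 fC]] [mg [D D0 gD]]; split; first exact: measurable_funD.
exists (C + D) => [|z Kz]; first exact: addr_ge0.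
by rewrite (le_trans (ler_normD _ _))// mulrDl lerD ?fC ?gD.
Qed.

Lemma growthM k l f g : growth k f -> growth l g ->
  growth (k + l) (fun z => f z * g z).
Proof.
move=> [mf [C C0 fC]] [mg [D D0 gD]]; split; first exact: measurable_funM.
exists (C * D) => [|z Kz]; first exact: mulr_ge0.
by rewrite normrM exprD mulrACA ler_pM ?fC ?gD.
Qed.

Lemma growth_continuous g : {within Q, continuous g} -> growth 0 g.
Proof.
move=> cg; split; first exact: within_continuous_measurable_spacetime.
have : compact (g @` K).
  by apply: continuous_compact => //; exact: continuous_subspaceW cg.
move=> /compact_bounded[M [Mr gM]]; exists (`|M| + 1) => [|z Kz].
  by rewrite addr_ge0.
rewrite expr0 mulr1; apply: gM; last by exists z.
by rewrite ltr_pwDr// ler_norm.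
Qed.

Lemma growth_cst (c : R) : growth 0 (fun=> c).
Proof.
by split=> //; exists `|c| => // z _; rewrite expr0 mulr1.
Qed.

Lemma growthN k g : growth k g -> growth k (fun z => - g z).
Proof.
move=> [mg [C C0 gC]]; split; last by exists C => // z Kz; rewrite normrN gC.
exact: measurable_funN.
Qed.

Lemma growthB k f g : growth k f -> growth k g -> growth k (fun z => f z - g z).
Proof. by move=> gf gg; apply: growthD => //; exact: growthN. Qed.

Lemma growth_sum (I : Type) (r : seq I) k (F : I -> E -> R) :
  (forall i, growth k (F i)) -> growth k (fun z => \sum_(i <- r) F i z).
Proof.
move=> gF; elim: r => [|i r IH].
  under eq_fun do rewrite big_nil.
  by apply: (@growthW 0) => //; exact: growth_cst.
by under eq_fun do rewrite big_cons; exact: growthD.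
Qed.

Lemma growth_velocity i : growth 1 (fun z => u z 0 i).
Proof.
split.
  apply: (measurableT_comp (f := fun v : 'rV[R]_d => v 0 i)) uL3.1.
  exact: measurable_coord.
exists 1 => // z Kz; rewrite mul1r expr1 (le_trans (le_enorm_coord _ _))//.
by rewrite /weight addrAC lerDr addr_ge0// sqrtr_ge0.
Qed.

Lemma growth_pressure : growth 2 p.
Proof.
split; first exact: pL32.1.
exists 1 => // z Kz; rewrite mul1r -[leLHS](@sqr_sqrtr _ `|p z|)//.
have w0 : 0 <= weight z by rewrite (le_trans _ (weight_ge1 z)).
by rewrite lerXn2r ?nnegrE ?sqrtr_ge0// /weight lerDr addr_ge0// enorm_ge0.
Qed.

Lemma measurable_enorm_velocity : measurable_fun Q (fun z => enorm (u z)).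
Proof.
apply: (measurableT_comp (f := @Num.sqrt R)).
  by apply: continuous_measurable_fun; exact: sqrt_continuous.
apply: (@measurable_sum _ _ _ _ _ _ (fun i z => u z 0 i * u z 0 i)) => i.
by apply: measurable_funM; exact: (growth_velocity i).1.
Qed.

Lemma product_measure_compact_lty : (mu K < +oo)%E.
Proof.
have [M [Mr bM]] := compact_bounded kK.
pose r := `|M| + 1.
have Mr1 : M < r by rewrite /r ltr_pwDr// ler_norm.
have sub : K `<=` box r `*` `[- r, r].
  move=> z Kz; have := bM _ Mr1 _ Kz; rewrite /= prod_normE/= ge_max => /andP[z1 z2].
  split; last by rewrite /= in_itv /= -ler_norml.
  move=> j; rewrite -ler_norml (le_trans _ z1)//.
  rewrite [leRHS](mx_normrE z.1).
  exact: (le_bigmax _ (fun ij : 'I_1 * 'I_d => `|z.1 ij.1 ij.2|) (0, j)).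
apply: (@le_lt_trans _ _ (mu (box r `*` `[- r, r]))).
  apply: le_measure; rewrite ?inE//; apply: measurableX => //.
  exact: measurable_box.
rewrite product_measure1E//; last exact: measurable_box.
apply: lte_mul_pinfty => //.
  by rewrite ge0_fin_numE// lebesgue_box_lty.
by rewrite /= lebesgue_measure_itv/=; case: ifP => _; rewrite ?ltry.
Qed.


(** The square root of |p| has cube |p|^(3/2), so degree three is exactly what the
hypotheses u in L^3 and p in L^(3/2) can bound. *)
Lemma weight_cube_le z :
  weight z ^+ 3 <= 27 * (1 + enorm (u z) `^ 3 + `|p z| `^ (3 / 2)).
Proof.
have a0 : 0 <= enorm (u z) by exact: enorm_ge0.
have b0 : 0 <= Num.sqrt `|p z| by exact: sqrtr_ge0.
rewrite /weight powR_mulrn//.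
have -> : `|p z| `^ (3 / 2) = Num.sqrt `|p z| ^+ 3.
  rewrite -powR_mulrn// -powR12_sqrt// -powRrM; congr (_ `^ _); lra.
move: a0 b0; generalize (enorm (u z)) (Num.sqrt `|p z|) => a b a0 b0.
have a3 : 0 <= a ^+ 3 by rewrite exprn_ge0.
have b3 : 0 <= b ^+ 3 by rewrite exprn_ge0.
(* compare with the largest of 1, a and b *)
have cube m : 1 + a + b <= 3 * m -> (1 + a + b) ^+ 3 <= 27 * m ^+ 3.
  move=> abm; have m0 : 0 <= m by lra.
  have -> : 27 * m ^+ 3 = (3 * m) ^+ 3 by ring.
  by rewrite lerXn2r// nnegrE; lra.
have [ab|ba] := leP a b; have [b1|b1] := leP b 1; have [a1|a1] := leP a 1.
- by have := cube 1; rewrite expr1n => /(_ ltac:(lra)); lra.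
- by lra.
- by have := cube b => /(_ ltac:(lra)); lra.
- by have := cube b => /(_ ltac:(lra)); lra.
- by have := cube 1; rewrite expr1n => /(_ ltac:(lra)); lra.
- by have := cube a => /(_ ltac:(lra)); lra.
- by lra.
- by have := cube a => /(_ ltac:(lra)); lra.
Qed.

Lemma integrable_weight : mu.-integrable K (EFin \o (fun z => weight z ^+ 3)).
Proof.
have mKQ g : measurable_fun Q g -> measurable_fun K g by exact: measurable_funS.
have mu3 : measurable_fun K (fun z => enorm (u z) `^ 3).
  apply: (measurableT_comp (f := @powR R ^~ 3)) => //.
  exact: mKQ measurable_enorm_velocity.
have mpa : measurable_fun K (fun z => `|p z|).
  by apply: measurableT_comp => //; exact: mKQ pL32.1.
have mp32 : measurable_fun K (fun z => `|p z| `^ (3 / 2)).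
  exact: (measurableT_comp (f := @powR R ^~ (3 / 2))).
have mw : measurable_fun K (fun z => weight z ^+ 3).
  apply: measurable_funX; apply: measurable_funD.
    by apply: measurable_funD => //; exact: mKQ measurable_enorm_velocity.
  apply: (measurableT_comp (f := @Num.sqrt R)) => //.
  by apply: continuous_measurable_fun; exact: sqrt_continuous.
have i1 : mu.-integrable K (EFin \o (fun=> 1)).
  apply: measurable_bounded_integrable => //; first exact: product_measure_compact_lty.
  by exists 1; split => // y y1 z _; rewrite normr1 ltW.
have iu : mu.-integrable K (EFin \o (fun z => enorm (u z) `^ 3)).
  apply/integrableP; split; first exact/measurable_EFinP.
  rewrite (_ : (fun z => _) = (fun z => (enorm (u z) `^ 3)%:E)).
    exact: uL3.2.
  by apply/funext => z /=; rewrite ger0_norm// powR_ge0.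
have ip : mu.-integrable K (EFin \o (fun z => `|p z| `^ (3 / 2))).
  apply/integrableP; split; first exact/measurable_EFinP.
  rewrite (_ : (fun z => _) = (fun z => (`|p z| `^ (3 / 2))%:E)).
    exact: pL32.2.
  by apply/funext => z /=; rewrite ger0_norm// powR_ge0.
have := integrableZl mKmu 27 (integrableD mKmu (integrableD mKmu i1 iu) ip).
apply: le_integrable => //; first exact/measurable_EFinP.
move=> z _ /=; rewrite lee_fin ger0_norm.
  exact: le_trans (weight_cube_le z) (ler_norm _).
by rewrite exprn_ge0// (le_trans _ (weight_ge1 z)).
Qed.

Lemma measurable_growth_cylinder k g : growth k g ->
  (forall z, cyl z -> ~ K z -> g z = 0) -> measurable_fun cyl g.
Proof.
move=> [mg _] g0; have mcyl := @measurable_cylinder R d Omega T oOmega.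
have -> : cyl = Q `|` (cyl `\` Q).
  by rewrite setDUK//; exact: rel_open_cylinder oQ.
apply/measurable_funU => //; first exact: measurableD.
split => //.
have : measurable_fun (cyl `\` Q) (cst 0 : E -> R) by exact: measurable_cst.
apply: eq_measurable_fun => z /set_mem[cz nQz] /=.
by rewrite g0// => /KQ.
Qed.

(** A quantity of degree at most three in the velocity and the square root of the
pressure is integrable, because u is in L^3 and p in L^(3/2). *)
Lemma growth_integrable g : growth 3 g ->
  (forall z, cyl z -> ~ K z -> g z = 0) -> mu.-integrable cyl (EFin \o g).
Proof.
move=> gg g0.
have mcyl : measurable (cyl : set Emu) by exact: measurable_cylinder.
have mgK := measurable_growth_cylinder gg g0.
have [mg [C C0 gC]] := gg.
have Kcyl : K `<=` cyl by apply: subset_trans KQ (rel_open_cylinder oQ).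
have : mu.-integrable K (EFin \o g).
  have := integrableZl mKmu C integrable_weight; apply: le_integrable => //.
    by apply/measurable_EFinP; exact: measurable_funS mg.
  move=> z Kz /=; rewrite lee_fin (le_trans (gC _ Kz))//.
  by rewrite ger0_norm// mulr_ge0// exprn_ge0// (le_trans _ (weight_ge1 z)).
move=> /(integrable_mkcond _ mKmu) iK; apply/(integrable_mkcond _ mcyl).
apply: eq_integrable iK => // z _; rewrite !patchE.
case: ifPn => [/set_mem/Kcyl/mem_set ->//|].
by rewrite notin_setE => nK; case: ifPn => // /set_mem cz; rewrite /= g0.
Qed.

End growth.

(** * Iterated integrals over space and time *)

(** The integral of a nonnegative function is a supremum over the simple
functions below it, hence monotone whether or not the functions are measurable. *)
Lemma le_integral_ge0 d (X : measurableType d) (R : realType)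
    (m : {measure set X -> \bar R}) (D : set X) (f g : X -> \bar R) :
  (forall x, D x -> (0 <= g x)%E) -> (forall x, D x -> (f x <= g x)%E) ->
  (\int[m]_(x in D) f x <= \int[m]_(x in D) g x)%E.
Proof.
move=> g0 fg; rewrite integralE; apply: (@le_trans _ _ (\int[m]_(x in D) f^\+ x)%E).
  by rewrite -[leRHS]adde0 leeD2l// oppe_le0 integral_ge0.
rewrite [leRHS]ge0_integralE// ge0_integralE//.
apply: ereal_sup_le => _ [h /= hf <-]; exists h => // x.
apply: le_trans (hf x) _; rewrite !patchE; case: ifPn => // /set_mem Dx.
by rewrite funeposE ge_max fg//= g0.
Qed.

Section spacetime_integrals.
Variables (R : realType) (d : nat) (Omega : set 'rV[R]_d) (T : R).
Hypotheses (oOmega : open Omega) (T0 : 0 < T).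
Local Notation E := ('rV[R]_d * R)%type.
Local Notation lam := (@lebesgue_measure R).
Local Notation leb := (lebesgue_rV R d).
Local Notation mu := (leb \x lam)%E.
Local Notation cyl := (cylinder Omega T).
Local Notation Emu := ('rV[R]_d * measurableTypeR R)%type.
Implicit Types (f g : E -> R).

Lemma measurable_open_rV (V : set 'rV[R]_d) : open V -> measurable V.
Proof.
move=> oV; rewrite (_ : V = (fun x => (x, 0 : R)) @^-1` (V `*` setT)); last first.
  by apply/seteqP; split => [x Vx|x []].
rewrite -[X in measurable X]setTI; apply: measurable_fun_pair => //.
apply: open_measurable_spacetime.
rewrite (_ : _ `*` _ = fst @^-1` V); last first.
  by apply/seteqP; split => z /=; [case|].
by apply: open_comp => // z _; exact: cvg_fst.
Qed.

Let mOmega : measurable Omega. Proof. exact: measurable_open_rV. Qed.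
Let mcyl : measurable (cyl : set Emu).
Proof. exact: (measurable_cylinder T oOmega). Qed.

Definition slab (tau : R) : set Emu := Omega `*` `[0, tau].

Lemma measurable_slab tau : measurable (slab tau).
Proof. exact: measurableX. Qed.

Lemma slab_cylinder tau : tau <= T -> slab tau `<=` cyl.
Proof.
move=> tT z [Oz /=]; rewrite in_itv/= => /andP[z0 zt].
by split => //=; rewrite z0 (le_trans zt).
Qed.

Lemma integrable_slab tau g : tau <= T -> mu.-integrable cyl (EFin \o g) ->
  mu.-integrable setT ((EFin \o g) \_ (slab tau)).
Proof.
move=> tT ig; apply/(integrable_mkcond _ (measurable_slab tau)).
by apply: integrableS (slab_cylinder tT) ig => //; exact: measurable_slab.
Qed.

(** Both iterated integrals below are sections of one integrable function on the
whole product space, to which Fubini applies. *)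
Lemma slab_slice tau g (x : 'rV[R]_d) (t : R) :
  ((EFin \o g) \_ (slab tau)) (x, t) =
  if (t \in `[0, tau]%classic) && (x \in Omega) then (g (x, t))%:E else 0%E.
Proof. by rewrite patchE /slab in_setX /= andbC. Qed.

Lemma spacetime_intE tau g : tau <= T -> mu.-integrable cyl (EFin \o g) ->
  spacetime_int Omega tau g = (\int[mu]_(z in slab tau) (g z)%:E)%E.
Proof.
move=> tT ig; rewrite [RHS]integral_mkcond.
rewrite -(integral21_prod_meas1 (integrable_slab tT ig)).
rewrite /spacetime_int integral_mkcond; apply: eq_integral => t _.
rewrite /fubini_G; under [in RHS]eq_integral do rewrite slab_slice.
rewrite patchE; case: ifPn => tt.
  by rewrite [LHS]integral_mkcond; apply: eq_integral => x _; rewrite patchE.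
by rewrite integral0_eq.
Qed.

Lemma spacetime_int_swap tau g : tau <= T -> mu.-integrable cyl (EFin \o g) ->
  spacetime_int Omega tau g =
  (\int[leb]_(x in Omega) \int[lam]_(t in `[0%R, tau]) (g (x, t))%:E)%E.
Proof.
move=> tT ig; rewrite spacetime_intE// integral_mkcond.
rewrite -(integral12_prod_meas1 (integrable_slab tT ig)).
rewrite [RHS]integral_mkcond; apply: eq_integral => x _.
rewrite /fubini_F; under eq_integral do rewrite slab_slice andbC.
rewrite patchE; case: ifPn => xO; last by rewrite integral0_eq.
by rewrite [in RHS]integral_mkcond; apply: eq_integral => t _; rewrite patchE.
Qed.

Lemma spacetime_int_fin_num tau g : tau <= T -> mu.-integrable cyl (EFin \o g) ->
  spacetime_int Omega tau g \is a fin_num.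
Proof.
move=> tT ig; rewrite spacetime_intE//; apply: integrable_fin_num.
  exact: measurable_slab.
by apply: integrableS (slab_cylinder tT) ig => //; exact: measurable_slab.
Qed.

Lemma integrable_cylinderD f g :
  mu.-integrable cyl (EFin \o f) -> mu.-integrable cyl (EFin \o g) ->
  mu.-integrable cyl (EFin \o (fun z => f z + g z)).
Proof. by move=> jf jg; exact: (integrableD mcyl jf jg). Qed.

Lemma integrable_cylinderB f g :
  mu.-integrable cyl (EFin \o f) -> mu.-integrable cyl (EFin \o g) ->
  mu.-integrable cyl (EFin \o (fun z => f z - g z)).
Proof. by move=> jf jg; exact: (integrableB mcyl jf jg). Qed.

Lemma spacetime_intD tau f g : tau <= T ->
  mu.-integrable cyl (EFin \o f) -> mu.-integrable cyl (EFin \o g) ->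
  spacetime_int Omega tau (fun z => f z + g z) =
  (spacetime_int Omega tau f + spacetime_int Omega tau g)%E.
Proof.
move=> tT jf jg; have ms := measurable_slab tau.
have jfg : mu.-integrable cyl (EFin \o (fun z => f z + g z)).
  exact: integrable_cylinderD.
rewrite !spacetime_intE//; apply: integralD_EFin => //.
  exact: integrableS (slab_cylinder tT) jf.
exact: integrableS (slab_cylinder tT) jg.
Qed.

Lemma spacetime_intB tau f g : tau <= T ->
  mu.-integrable cyl (EFin \o f) -> mu.-integrable cyl (EFin \o g) ->
  spacetime_int Omega tau (fun z => f z - g z) =
  (spacetime_int Omega tau f - spacetime_int Omega tau g)%E.
Proof.
move=> tT jf jg; have ms := measurable_slab tau.
have jfg : mu.-integrable cyl (EFin \o (fun z => f z - g z)).
  exact: integrable_cylinderB.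
rewrite !spacetime_intE//; apply: integralB_EFin => //.
  exact: integrableS (slab_cylinder tT) jf.
exact: integrableS (slab_cylinder tT) jg.
Qed.

Lemma eq_spacetime_int tau f g : tau <= T -> (forall z, cyl z -> f z = g z) ->
  spacetime_int Omega tau f = spacetime_int Omega tau g.
Proof.
move=> tT fg; apply: eq_integral => t /set_mem /=; rewrite in_itv/= => /andP[t0 tt].
apply: eq_integral => x /set_mem Ox; rewrite fg//.
by split => //=; rewrite t0 (le_trans tt).
Qed.

Lemma measurable_slice g t : measurable_fun cyl g -> 0 <= t <= T ->
  measurable_fun Omega (fun x => g (x, t)).
Proof.
move=> mg tT; apply: (measurable_comp _ _ mg (g := fun x => (x, t))).
- exact: measurable_cylinder.
- by move=> _ [x Ox <-].
- by apply: measurable_funTS; exact: measurable_fun_pair.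
Qed.

Lemma ae_integrable_slice g : mu.-integrable cyl (EFin \o g) ->
  {ae lam, forall t, 0 <= t <= T ->
    leb.-integrable Omega (fun x => (g (x, t))%:E)}.
Proof.
move=> ig; have := ae_integrable2 (integrable_slab (lexx T) ig).
apply: filterS => t it tT; apply/(integrable_mkcond _ mOmega).
apply: eq_integrable it => // x _; rewrite slab_slice patchE.
by rewrite (_ : t \in _)// inE /= in_itv.
Qed.

Lemma measurable_space_int tau g : tau <= T -> mu.-integrable cyl (EFin \o g) ->
  measurable_fun `[0, tau] (fun t => space_int Omega (fun x => g (x, t))).
Proof.
move=> tT ig; have ig' := integrable_slab tT ig.
have : measurable_fun `[0, tau] (fubini_G leb ((EFin \o g) \_ (slab tau))).
  by apply: measurable_funTS; exact: measurable_fubini_G ig'.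
apply: eq_measurable_fun => t tt; rewrite /fubini_G /space_int.
rewrite [RHS]integral_mkcond; apply: eq_integral => x _.
by rewrite slab_slice tt patchE.
Qed.

(** The initial time, about which the hypothesis says nothing, is negligible. *)
Lemma spacetime_int_ae0 tau g : tau <= T -> mu.-integrable cyl (EFin \o g) ->
  {ae lam, forall t, 0 < t <= tau -> space_int Omega (fun x => g (x, t)) = 0%E} ->
  spacetime_int Omega tau g = 0%E.
Proof.
move=> tT ig ae0; rewrite -(integral0 lam `[0, tau]%classic).
apply: ae_eq_integral => //; first exact: measurable_space_int.
have n0 : {ae lam, forall t, t != 0}.
  apply/negligibleP.
    rewrite (_ : ~` _ = [set 0]); first exact: measurable_set1.
    by apply/seteqP; split => t /=; [move/negP/negPn/eqP|move=> ->; rewrite eqxx].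
  rewrite (_ : ~` _ = [set 0]); first exact: lebesgue_measure_set1.
  by apply/seteqP; split => t /=; [move/negP/negPn/eqP|move=> ->; rewrite eqxx].
apply: (@filterS2 _ _ (ae_filter_ringOfSetsType lam) _ _ _ _ n0 ae0).
move=> t t0 + tt; apply.
by move: tt; rewrite /= in_itv/= le_eqVlt eq_sym (negbTE t0).
Qed.

Lemma spacetime_int_sum0 tau (I : Type) (r : seq I) (F : I -> E -> R) :
  tau <= T -> (forall i, mu.-integrable cyl (EFin \o F i)) ->
  (forall i, spacetime_int Omega tau (F i) = 0%E) ->
  spacetime_int Omega tau (fun z => \sum_(i <- r) F i z) = 0%E.
Proof.
move=> tT iF F0; suff : mu.-integrable cyl (EFin \o (fun z => \sum_(i <- r) F i z)) /\
    spacetime_int Omega tau (fun z => \sum_(i <- r) F i z) = 0%E by case.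
elim: r => [|i r [IH1 IH2]].
  under eq_fun do rewrite big_nil; split; first exact: integrable0.
  by apply: integral0_eq => t _; apply: integral0_eq.
under eq_fun do rewrite big_cons; split.
  exact: (integrableD mcyl (iF i) IH1).
by rewrite spacetime_intD// IH2 F0 adde0.
Qed.

Lemma space_intD (f g : 'rV[R]_d -> R) :
  leb.-integrable Omega (EFin \o f) -> leb.-integrable Omega (EFin \o g) ->
  leb.-integrable Omega (EFin \o (fun x => f x + g x)) /\
  space_int Omega (fun x => f x + g x) = (space_int Omega f + space_int Omega g)%E.
Proof.
move=> jf jg; split; last exact: integralD_EFin.
exact: (integrableD mOmega jf jg).
Qed.

Lemma space_intB (f g : 'rV[R]_d -> R) :
  leb.-integrable Omega (EFin \o f) -> leb.-integrable Omega (EFin \o g) ->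
  leb.-integrable Omega (EFin \o (fun x => f x - g x)) /\
  space_int Omega (fun x => f x - g x) = (space_int Omega f - space_int Omega g)%E.
Proof.
move=> jf jg; split; last exact: integralB_EFin.
exact: (integrableB mOmega jf jg).
Qed.

(** Test functions have no boundary terms in space; in time they contribute their
values at the two ends of the interval. *)
Section test_functions.
Variable Q : set E.
Hypothesis oQ : rel_open Omega T Q.

(** The box does not depend on time, so one box serves all slices. *)
Lemma tsupport_box (f : E -> R) : compact (tsupport f) ->
  exists2 r, 0 < r & forall x t, ~ box r x -> ~ tsupport f (x, t).
Proof.
move=> /compact_bounded[M [Mr bM]]; exists (`|M| + 1); first by rewrite ltr_wpDl.
have Mr1 : M < `|M| + 1 by rewrite ltr_pwDr// ler_norm.
move=> x t nb sx; have := bM _ Mr1 _ sx; rewrite /= prod_normE/= ge_max => /andP[xr _].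
apply: nb => j; rewrite -ler_norml (le_trans _ xr)// [leRHS](mx_normrE x).
exact: (le_bigmax _ (fun ij : 'I_1 * 'I_d => `|x ij.1 ij.2|) (0, j)).
Qed.

Lemma integrable_test_slice f t : 0 <= t <= T -> C1_compact T Q f ->
  leb.-integrable Omega (fun x => (f (x, t))%:E).
Proof.
move=> tT Cf; have [_ kf fQ] := Cf.
have [cf _ _] := C1_compact_on_cylinder T0 oQ Cf.
have f0 z : ~ tsupport f z -> f z = 0.
  by move=> /near_tsupport; exact: nbhs_singleton.
have [r r0 outbox] := tsupport_box kf.
apply: (@integrableS _ _ _ _ setT) => //.
apply: (@integrable_continuous_box _ _ (fun x => f (x, t)) r).
  apply: (slice_space_continuous oOmega oQ _ fQ cf f0 tT).
  exact: closed_closure.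
by move=> x /(outbox _ t); exact: f0.
Qed.

Lemma spacetime_int_dt tau f : 0 < tau <= T -> C1_compact T Q f ->
  mu.-integrable cyl (EFin \o dt T f) ->
  spacetime_int Omega tau (dt T f) =
  space_int Omega (fun x => f (x, tau) - f (x, 0)).
Proof.
move=> tT Cf ig; have /andP[t0 tT'] := tT.
rewrite spacetime_int_swap//; apply: eq_integral => x /set_mem Ox.
by rewrite (FTC_dt (C1_compact_on_cylinder T0 oQ Cf)).
Qed.

Lemma space_int_dx i f t : 0 <= t <= T -> C1_compact T Q f ->
  space_int Omega (fun x => dx i f (x, t)) = 0%E.
Proof.
move=> tT Cf; have [[_ _ /(_ i)[dxf cdxf]] kf fQ] := Cf.
have [_ _ /(_ i)[dxc cdxc]] := C1_compact_on_cylinder T0 oQ Cf.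
have nsupp x : ~ Omega x -> ~ tsupport f (x, t).
  by move=> nO /fQ/(rel_open_cylinder oQ)[].
have dE := dx_slice i f.
have dslice x : derivable (fun x => f (x, t)) x (delta_mx 0 i).
  apply: (dE x t).1.1; have [Ox|nOx] := pselect (Omega x); first exact: dxc.
  by have [] := dx_tsupport i (nsupp _ nOx).
have [r r0 outbox] := tsupport_box kf.
rewrite /space_int integral_mkcond.
rewrite (_ : _ \_ _ = fun x => ('D_(delta_mx 0 i) (fun x => f (x, t)) x)%:E).
  apply: (@integral_derive_box _ _ _ _ r) => //.
  - rewrite (_ : 'D_(delta_mx 0 i) _ = (fun x => dx i f (x, t))).
      apply: (slice_space_continuous oOmega oQ _ fQ cdxc _ tT) => [|z nz].
        exact: closed_closure.
      by have [] := dx_tsupport i nz.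
    by apply/funext => x; rewrite (dE x t).2.
  - by move=> x /(outbox _ t) nx; exact: nbhs_singleton (near_tsupport nx).
  - by move=> x /(outbox _ t) nx; rewrite -(dE x t).2; have [] := dx_tsupport i nx.
apply/funext => x; rewrite patchE -(dE x t).2; case: ifPn => //.
by rewrite notin_setE => /nsupp nx; have [_ ->] := dx_tsupport i nx.
Qed.

Lemma spacetime_int_dx i tau f : tau <= T -> C1_compact T Q f ->
  spacetime_int Omega tau (dx i f) = 0%E.
Proof.
move=> tT Cf; apply: integral0_eq => t; rewrite /= in_itv/= => /andP[t0 tt].
by rewrite space_int_dx// t0 (le_trans tt).
Qed.

End test_functions.
End spacetime_integrals.

(** * The relative energy balance *)

Section relative_energy.
Variables (R : realType) (d : nat) (Omega : set 'rV[R]_d) (T : R).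
Local Notation E := ('rV[R]_d * R)%type.
Local Notation lam := (@lebesgue_measure R).
Local Notation leb := (lebesgue_rV R d).
Local Notation mu := (leb \x lam)%E.
Local Notation cyl := (cylinder Omega T).
Variables (Q : set E) (phi : E -> R) (u U : E -> 'rV[R]_d) (p P : E -> R).
Variable u0 : 'rV[R]_d -> 'rV[R]_d.
Hypotheses (oOmega : open Omega) (T0 : 0 < T) (oQ : rel_open Omega T Q).
Hypotheses (Cphi : C1_compact T Q phi) (phi0 : forall z, 0 <= phi z).
Hypothesis Usol : strong_solution T Q U P.

Let QT z : Q z -> 0 <= z.2 <= T. Proof. exact: rel_open_time oQ z. Qed.
Let CphiQ : C1_on T Q phi. Proof. by case: Cphi. Qed.
Let CU i : C1_on T Q (component i U). Proof. by have [/(_ i)[]] := Usol. Qed.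
Let CP : C1_on T Q P. Proof. by have [_ []] := Usol. Qed.

Definition half_sq (z : E) : R := 2^-1 * dot (U z) (U z).

(** The three test functions: the cut-off kinetic energy, velocity and pressure of
the strong solution. *)
Definition phiUU (z : E) : R := phi z * half_sq z.
Definition phiU (z : E) : 'rV[R]_d := phi z *: U z.
Definition phiP (z : E) : R := phi z * P z.

Lemma C1_half_sq : C1_on T Q half_sq /\ forall z, Q z ->
  dt T half_sq z = dot (U z) (dt_vec T U z) /\ grad half_sq z = U z *m jac U z.
Proof.
pose F i z := component i U z * component i U z.
have CF i : C1_on T Q (F i) by exact: (C1_onM T0 QT).
have [CS dS] := C1_on_sum T0 QT (index_enum 'I_d) CF.
have C2 := C1_on_cst T0 QT (2^-1).
split; first exact: (C1_onM T0 QT C2 CS).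
move=> z Qz; have [tS xS] := dS _ Qz; split.
  rewrite [LHS](C1_dtM T0 QT C2 CS Qz) (dt_cst T0 2^-1 (QT Qz)).2 mul0r add0r tS.
  rewrite mulr_sumr; apply: eq_bigr => i _.
  by rewrite (C1_dtM T0 QT (CU i) (CU i) Qz) mxE /component; lra.
apply/rowP => j; rewrite !mxE.
rewrite [LHS](C1_dxM j C2 CS Qz) (dx_cst j 2^-1 z).2 mul0r add0r xS.
rewrite mulr_sumr; apply: eq_bigr => i _.
by rewrite (C1_dxM j (CU i) (CU i) Qz) mxE /component; lra.
Qed.

Lemma component_phiU i : component i phiU = fun z => phi z * component i U z.
Proof. by apply/funext => z; rewrite /component mxE. Qed.

Lemma C1_phiUU : C1_compact T Q phiUU.
Proof. exact: (C1_compactM T0 QT Cphi C1_half_sq.1). Qed.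

Lemma C1_phiU i : C1_compact T Q (component i phiU).
Proof. by rewrite component_phiU; exact: (C1_compactM T0 QT Cphi (CU i)). Qed.

Lemma C1_phiP : C1_compact T Q phiP.
Proof. exact: (C1_compactM T0 QT Cphi CP). Qed.

Lemma gradM f g z : C1_on T Q f -> C1_on T Q g -> Q z ->
  grad (fun z => f z * g z) z = g z *: grad f z + f z *: grad g z.
Proof.
move=> Cf Cg Qz; apply/rowP => j; rewrite !mxE (C1_dxM j Cf Cg Qz).
by rewrite mulrC.
Qed.

Lemma dt_phiUU z : Q z ->
  dt T phiUU z = dt T phi z * half_sq z + phi z * dot (U z) (dt_vec T U z).
Proof.
by move=> Qz; rewrite (C1_dtM T0 QT CphiQ C1_half_sq.1 Qz) (C1_half_sq.2 _ Qz).1.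
Qed.

Lemma grad_phiUU z : Q z ->
  grad phiUU z = half_sq z *: grad phi z + phi z *: (U z *m jac U z).
Proof.
by move=> Qz; rewrite (gradM CphiQ C1_half_sq.1 Qz) (C1_half_sq.2 _ Qz).2.
Qed.

Lemma dt_vec_phiU z : Q z ->
  dt_vec T phiU z = dt T phi z *: U z + phi z *: dt_vec T U z.
Proof.
move=> Qz; apply/rowP => i.
by rewrite !mxE component_phiU (C1_dtM T0 QT CphiQ (CU i) Qz).
Qed.

Lemma div_phiU z : Q z ->
  div phiU z = dot (grad phi z) (U z) + phi z * div U z.
Proof.
move=> Qz; rewrite /div /dot mulr_sumr -big_split; apply: eq_bigr => i _.
by rewrite component_phiU (C1_dxM i CphiQ (CU i) Qz) mxE.
Qed.

Lemma frob_jac_phiU z v : Q z -> frob (jac phiU z) (tensor v v) =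
  dot (grad phi z) v * dot (U z) v + phi z * dot v (v *m (jac U z)^T).
Proof.
move=> Qz; rewrite -frob_jac_tensor.
have -> : dot (grad phi z) v * dot (U z) v =
    \sum_i \sum_j (U z 0 i * v 0 i) * (grad phi z 0 j * v 0 j).
  by rewrite mulrC mulr_suml; apply: eq_bigr => i _; rewrite mulr_sumr.
rewrite /frob mulr_sumr -big_split; apply: eq_bigr => i _ /=.
rewrite mulr_sumr -big_split; apply: eq_bigr => j _ /=.
by rewrite !mxE component_phiU (C1_dxM j CphiQ (CU i) Qz) /component; ring.
Qed.

(** Since U is solenoidal, div (U tensor U) = (U . grad) U. *)
Lemma strong_momentum z : Q z ->
  dt_vec T U z = - (U z *m (jac U z)^T) - grad P z.
Proof.
move=> Qz; have [_ _ /(_ _ Qz)[eqU divU]] := Usol.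
have -> : U z *m (jac U z)^T = div_tensor (fun y => tensor (U y) (U y)) z.
  apply/rowP => i; rewrite !mxE.
  transitivity (\sum_j (dx j (component i U) z * component j U z +
      component i U z * dx j (component j U) z)).
    rewrite big_split/= -mulr_sumr -/(div U z) divU mulr0 addr0.
    by apply: eq_bigr => j _; rewrite !mxE mulrC.
  apply: eq_bigr => j _; rewrite -(C1_dxM j (CU i) (CU j) Qz).
  by congr dx; apply/funext => y; rewrite mxE.
by move/eqP: eqU; rewrite -addrA addr_eq0 => /eqP ->; rewrite opprD.
Qed.


Definition rel_density (z : E) : R := phi z * enorm (u z - U z) ^+ 2.

Definition energy_flux (z : E) : R :=
  2^-1 * dt T phi z * enorm (u z) ^+ 2
  + dot (grad phi z) ((enorm (u z) ^+ 2 / 2 + p z) *: u z).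

Definition momentum_flux (z : E) : R :=
  dot (dt_vec T phiU z) (u z) + frob (jac phiU z) (tensor (u z) (u z))
  + p z * div phiU z.

Definition rel_flux (z : E) : R :=
  2^-1 * dt T phi z * enorm (U z - u z) ^+ 2
  + dot (grad phi z) ((enorm (U z - u z) ^+ 2 / 2) *: u z
      + (P z - p z) *: (U z - u z)).

(** Half of the stretching term - phi w . grad U w. The factor makes it comparable
with the relative energy, which carries the same factor one half. *)
Definition half_remainder (z : E) : R :=
  2^-1 * (phi z * - dot (u z - U z) ((u z - U z) *m (jac U z)^T)).

(** The algebraic heart of the argument. Eliminating the time derivative of U by
the strong equation leaves the convective terms (u . grad U) . u +
(U . grad U) . (U - u), which equal (w . grad U) . w + u . grad (|U|^2 / 2) for
w = u - U. The gradients, once multiplied by phi, combine with the terms carrying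
grad phi into the last three terms, each of which integrates to zero. *)
Lemma flux_identity z : Q z ->
  rel_flux z + (half_remainder z + half_remainder z) =
  energy_flux z - momentum_flux z + dt T phiUU z + dot (u z) (grad phiUU z)
  - dot (u z) (grad phiP z) + dot (U z) (grad phiP z).
Proof.
move=> Qz; have [_ _ /(_ _ Qz)[_ divU]] := Usol.
rewrite /rel_flux /half_remainder /energy_flux /momentum_flux.
rewrite frob_jac_phiU// div_phiU// divU dt_vec_phiU// dt_phiUU// grad_phiUU//.
rewrite (gradM CphiQ CP Qz) strong_momentum// /half_sq !enorm_sqr mulmxBl.
rewrite !(dotBl, dotBr, dotDl, dotDr, dotZl, dotZr, dotNl, dotNr).
have -> : dot (u z) (U z *m jac U z) = dot (U z) (u z *m (jac U z)^T).
  by rewrite dotC -dot_mulmx.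
rewrite ![dot (_ *m _) _]dotC [dot (U z) (u z)]dotC ![dot (grad _ _) _]dotC.

by field.
Qed.


Let K := tsupport phi.
Hypotheses (uL3 : L3_loc Q u) (pL32 : L32_loc Q p).

Let KQ : K `<=` Q. Proof. by case: Cphi. Qed.
Let kK : compact K. Proof. by case: Cphi. Qed.
Let clK : closed K. Proof. exact: closed_closure. Qed.

Local Notation growth := (growth Q K u p).
Definition vgrowth k (f : E -> 'rV[R]_d) := forall i, growth k (fun z => f z 0 i).

Lemma C1_growth f : C1_on T Q f ->
  [/\ growth 0 f, growth 0 (dt T f) & vgrowth 0 (grad f)].
Proof.
move=> [cf [_ ctf] xf]; split.
- exact: (growth_continuous oOmega u p oQ kK KQ cf).
- exact: (growth_continuous oOmega u p oQ kK KQ ctf).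
- move=> i; under eq_fun do rewrite mxE.
  exact: (growth_continuous oOmega u p oQ kK KQ (xf i).2).
Qed.

Lemma vgrowthD k f g : vgrowth k f -> vgrowth k g -> vgrowth k (fun z => f z + g z).
Proof.
by move=> vf vg i; under eq_fun do rewrite mxE; exact: growthD.
Qed.

Lemma vgrowthW k l f : (k <= l)%N -> vgrowth k f -> vgrowth l f.
Proof. by move=> kl vf i; exact: growthW (vf i). Qed.

Lemma vgrowthB k f g : vgrowth k f -> vgrowth k g -> vgrowth k (fun z => f z - g z).
Proof.
by move=> vf vg i; under eq_fun do rewrite !mxE; exact: growthB.
Qed.

Lemma vgrowthZ k l a f : growth k a -> vgrowth l f ->
  vgrowth (k + l) (fun z => a z *: f z).
Proof.
by move=> ga vf i; under eq_fun do rewrite !mxE; exact: growthM.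
Qed.

Lemma growth_dot k l f g : vgrowth k f -> vgrowth l g ->
  growth (k + l) (fun z => dot (f z) (g z)).
Proof.
move=> vf vg; apply: growth_sum => i; exact: growthM.
Qed.

Lemma growth_enorm_sqr f : vgrowth 1 f -> growth 2 (fun z => enorm (f z) ^+ 2).
Proof.
by move=> vf; under eq_fun do rewrite enorm_sqr; exact: (growth_dot vf vf).
Qed.

Lemma vgrowth_mulmx k l f (A : E -> 'M[R]_d) : vgrowth k f ->
  (forall i j, growth l (fun z => A z i j)) ->
  vgrowth (k + l) (fun z => f z *m A z).
Proof.
move=> vf gA j; under eq_fun do rewrite mxE.
by apply: growth_sum => i; exact: growthM.
Qed.

Let vu : vgrowth 1 u. Proof. by move=> i; exact: growth_velocity. Qed.
Let gp : growth 2 p. Proof. exact: growth_pressure. Qed.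
Let vU : vgrowth 0 U. Proof. by move=> i; have [] := C1_growth (CU i). Qed.
Let vU1 : vgrowth 1 U. Proof. exact: vgrowthW vU. Qed.
Let gc c : growth 0 (fun=> c).
Proof. exact: growth_cst. Qed.
Let gjac f : (forall i, C1_on T Q (component i f)) ->
  forall i j, growth 0 (fun z => jac f z i j).
Proof.
move=> Cf i j; have [_ _ /(_ j)] := C1_growth (Cf i).
by under eq_fun do rewrite mxE; under [X in _ -> growth _ X]eq_fun do rewrite mxE.
Qed.
Let gphi : [/\ growth 0 phi, growth 0 (dt T phi) & vgrowth 0 (grad phi)].
Proof. exact: C1_growth. Qed.
Let CzQ i : C1_on T Q (component i phiU). Proof. by have [] := C1_phiU i. Qed.

Lemma off_support f z : tsupport f `<=` K -> cyl z -> ~ K z ->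
  [/\ f z = 0, dt T f z = 0 & grad f z = 0].
Proof.
move=> sf cz nz; have {}nz : ~ tsupport f z by move=> /sf.
split; first exact: nbhs_singleton (near_tsupport nz).
  by have [] := dt_tsupport T0 cz.2 nz.
by apply/rowP => i; rewrite !mxE; have [] := dx_tsupport i nz.
Qed.

Let off_phi z : cyl z -> ~ K z -> [/\ phi z = 0, dt T phi z = 0 & grad phi z = 0].
Proof. exact: off_support. Qed.
Let off_phiUU z : cyl z -> ~ K z -> [/\ phiUU z = 0, dt T phiUU z = 0 & grad phiUU z = 0].
Proof. by apply: off_support; exact: tsupportM. Qed.
Let off_phiP z : cyl z -> ~ K z ->
  [/\ phiP z = 0, dt T phiP z = 0 & grad phiP z = 0].
Proof. by apply: off_support; exact: tsupportM. Qed.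
Let off_phiU i z : cyl z -> ~ K z -> [/\ component i phiU z = 0,
  dt T (component i phiU) z = 0 & grad (component i phiU) z = 0].
Proof. by apply: off_support; rewrite component_phiU; exact: tsupportM. Qed.

Let growth_integ g : growth 3 g -> (forall z, cyl z -> ~ K z -> g z = 0) ->
  mu.-integrable cyl (EFin \o g).
Proof. exact: growth_integrable. Qed.

Lemma fluxes_off_support z : cyl z -> ~ K z -> [/\ energy_flux z = 0,
  momentum_flux z = 0, rel_flux z = 0 & half_remainder z = 0].
Proof.
move=> cz nz; have [z0 t0 x0] := off_phi cz nz; split.
- by rewrite /energy_flux t0 x0 dot0l mulr0 mul0r addr0.
- have zeta0 i := off_phiU i cz nz.
  rewrite /momentum_flux (_ : dt_vec T phiU z = 0) ?dot0l; last first.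
    by apply/rowP => i; rewrite !mxE; have [] := zeta0 i.
  rewrite (_ : jac phiU z = 0) ?frob_jac_tensor ?trmx0 ?mulmx0 ?dot0r; last first.
    apply/matrixP => i j; rewrite !mxE.
    by have [_ _ /rowP/(_ j)] := zeta0 i; rewrite !mxE.
  rewrite (_ : div phiU z = 0) ?mulr0 ?addr0//.
  by apply: big1 => i _; have [_ _ /rowP/(_ i)] := zeta0 i; rewrite !mxE.
- by rewrite /rel_flux t0 x0 dot0l mulr0 mul0r addr0.
- by rewrite /half_remainder z0 mul0r mulr0.
Qed.

Lemma integrable_energy_flux : mu.-integrable cyl (EFin \o energy_flux).
Proof.
have [g0 gt gx] := gphi.
apply: growth_integ => [|z cz nz]; last by have [] := fluxes_off_support cz nz.
apply: growthD.
  apply: (@growthW _ _ _ _ _ _ 2) => //.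
  exact: (growthM (growthM (gc _) gt) (growth_enorm_sqr vu)).
apply: (growth_dot gx); apply: (@vgrowthZ 2 1) => //.
by apply: growthD => //; exact: (growthM (growth_enorm_sqr vu) (gc _)).
Qed.

Lemma integrable_momentum_flux : mu.-integrable cyl (EFin \o momentum_flux).
Proof.
apply: growth_integ => [|z cz nz]; last by have [] := fluxes_off_support cz nz.
apply: (@growthW _ _ _ _ _ _ 2) => //; apply: growthD; first apply: growthD.
- apply: (@growthW _ _ _ _ _ _ 1) => //; apply: (@growth_dot 0 1) => // i.
  by under eq_fun do rewrite mxE; have [] := C1_growth (CzQ i).
- under eq_fun do rewrite frob_jac_tensor; apply: (growth_dot vu).
  apply: (@vgrowth_mulmx 1 0) => // i j; under eq_fun do rewrite mxE.
  exact: gjac.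
- apply: (@growthM _ _ _ _ _ _ 2 0) => //.
  apply: growth_sum => i.
  have [_ _ /(_ i)] := C1_growth (CzQ i).
  by under eq_fun do rewrite mxE.
Qed.

Lemma integrable_rel_flux : mu.-integrable cyl (EFin \o rel_flux).
Proof.
have [g0 gt gx] := gphi.
have vw : vgrowth 1 (fun z => U z - u z) by exact: vgrowthB.
have [gP _ _] := C1_growth CP.
apply: growth_integ => [|z cz nz]; last by have [] := fluxes_off_support cz nz.
apply: growthD.
  apply: (@growthW _ _ _ _ _ _ 2) => //.
  exact: (growthM (growthM (gc _) gt) (growth_enorm_sqr vw)).
apply: (growth_dot gx); apply: vgrowthD.
  apply: (@vgrowthZ 2 1) => //.
  exact: (growthM (growth_enorm_sqr vw) (gc _)).
apply: (@vgrowthZ 2 1) => //; apply: growthB => //.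
exact: growthW gP.
Qed.

Lemma integrable_half_remainder : mu.-integrable cyl (EFin \o half_remainder).
Proof.
have [g0 gt gx] := gphi.
have vw : vgrowth 1 (fun z => u z - U z) by exact: vgrowthB.
apply: growth_integ => [|z cz nz]; last by have [] := fluxes_off_support cz nz.
apply: (@growthW _ _ _ _ _ _ 2) => //.
apply: (growthM (gc _)); apply: (growthM g0); apply: growthN.
apply: (growth_dot vw); apply: (@vgrowth_mulmx 1 0) => // i j.
by under eq_fun do rewrite mxE; exact: gjac.
Qed.

Lemma integrable_test f (v : E -> 'rV[R]_d) : C1_compact T Q f ->
  tsupport f `<=` K -> vgrowth 1 v -> [/\ mu.-integrable cyl (EFin \o f),
    mu.-integrable cyl (EFin \o dt T f),
    mu.-integrable cyl (EFin \o (fun z => dot (v z) (grad f z))) &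
    forall i, mu.-integrable cyl (EFin \o dx i f)].
Proof.
move=> [/C1_growth[g0 gt gx] _ _] sf vv; split => [||| i]; apply: growth_integ.
- exact: growthW g0.
- by move=> z cz nz; have [] := off_support sf cz nz.
- exact: growthW gt.
- by move=> z cz nz; have [] := off_support sf cz nz.
- by apply: (@growthW _ _ _ _ _ _ 1) => //; exact: (growth_dot vv gx).
- by move=> z cz nz; have [_ _ ->] := off_support sf cz nz; rewrite dot0r.
- by have := gx i; under eq_fun do rewrite mxE; exact: growthW.
- move=> z cz nz; have [_ _ /rowP/(_ i)] := off_support sf cz nz.
  by rewrite !mxE.
Qed.


(** Each of the three terms is governed by a different identity: the local energy
inequality, the weak momentum equation tested with phi U, and the fundamental theorem
of calculus for phi |U|^2 / 2. *)
Lemma rel_density_expand z :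
  rel_density z = phi z * enorm (u z) ^+ 2
    - (dot (u z) (phiU z) + dot (u z) (phiU z)) + (phiUU z + phiUU z).
Proof.
rewrite /rel_density /phiUU /phiU /half_sq !enorm_sqr.
by rewrite !(dotBl, dotBr, dotZr) (dotC (U z) (u z)); lra.
Qed.

Lemma integrable_kinetic :
  mu.-integrable cyl (EFin \o (fun z => phi z * enorm (u z) ^+ 2)).
Proof.
have [g0 _ _] := gphi.
apply: growth_integ => [|z cz nz]; last first.
  by have [-> _ _] := off_phi cz nz; rewrite mul0r.
apply: (@growthW _ _ _ _ _ _ 2) => //.
exact: (growthM g0 (growth_enorm_sqr vu)).
Qed.

Lemma integrable_cross : mu.-integrable cyl (EFin \o (fun z => dot (u z) (phiU z))).
Proof.
have [g0 _ _] := gphi.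
apply: growth_integ => [|z cz nz]; last first.
  by have [z0 _ _] := off_phi cz nz; rewrite /phiU z0 scale0r dot0r.
apply: (@growthW _ _ _ _ _ _ 1) => //.
exact: (growth_dot vu (vgrowthZ g0 vU)).
Qed.

Lemma measurable_rel_density : measurable_fun cyl rel_density.
Proof.
have [g0 _ _] := gphi.
have vw : vgrowth 1 (fun z => u z - U z) by exact: vgrowthB.
apply: (measurable_growth_cylinder oOmega oQ KQ (k := 2) (u := u) (p := p)).
  exact: (growthM g0 (growth_enorm_sqr vw)).
by move=> z cz nz; have [z0 _ _] := off_phi cz nz; rewrite /rel_density z0 mul0r.
Qed.

Lemma rel_density_ge0 z : 0 <= rel_density z.
Proof. by rewrite mulr_ge0// sqr_ge0. Qed.

Lemma half_remainder_le z : Q z ->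
  half_remainder z <= op_norm (sym_grad U z) * (2^-1 * rel_density z).
Proof.
move=> Qz; have := quadratic_form_le (u z - U z) (jac U z).
rewrite -/(sym_grad U z) => le.
rewrite /half_remainder /rel_density [leRHS]mulrCA ler_wpM2l ?invr_ge0//.
by rewrite [leRHS]mulrCA ler_wpM2l.
Qed.

Lemma sym_grad_sup_ge0 t : (0 <= sym_grad_sup Q U t)%E.
Proof. by apply: ereal_sup_ubound; left. Qed.

Lemma op_norm_sym_grad_sup x t : Q (x, t) ->
  ((op_norm (sym_grad U (x, t)))%:E <= sym_grad_sup Q U t)%E.
Proof. by move=> Qxt; apply: ereal_sup_ubound; right; exists x. Qed.

(** Pulling the factor [sym_grad_sup] out of the integral covers an infinite value
as well: where the density vanishes so does the remainder, in accordance with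
0 * oo = 0. *)
Lemma space_int_half_remainder_le t : 0 <= t <= T ->
  (space_int Omega (fun x => half_remainder (x, t))
   <= sym_grad_sup Q U t * rel_energy Omega phi u U t)%E.
Proof.
move=> tT.
have mrd : measurable_fun Omega (fun x => (rel_density (x, t))%:E).
  by apply/measurable_EFinP; exact: measurable_slice measurable_rel_density tT.
have mO : measurable Omega by exact: measurable_open_rV.
rewrite /rel_energy /space_int -ge0_integralZl_EFin//; last first.
  by move=> x _; rewrite lee_fin rel_density_ge0.
rewrite -ge0_integralZl//; last 3 first.
- exact: measurable_funeM.
- by move=> x _; rewrite -EFinM lee_fin mulr_ge0// rel_density_ge0.
- exact: sym_grad_sup_ge0.
have rd0 x : (0 <= (2^-1)%:E * (rel_density (x, t))%:E)%E.
  by rewrite -EFinM lee_fin mulr_ge0// rel_density_ge0.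
apply: le_integral_ge0 => x Ox; first exact: mule_ge0 (sym_grad_sup_ge0 t) (rd0 x).
have [Qxt|nQ] := pselect (Q (x, t)).
  apply: (@le_trans _ _ ((op_norm (sym_grad U (x, t)))%:E *
      ((2^-1)%:E * (rel_density (x, t))%:E))%E).
    by rewrite -!EFinM lee_fin half_remainder_le.
  exact: (lee_wpmul2r (rd0 x) (op_norm_sym_grad_sup Qxt)).
have [z0 _ _] : [/\ phi (x, t) = 0, dt T phi (x, t) = 0 & grad phi (x, t) = 0].
  by apply: off_phi => // /KQ.
have -> : half_remainder (x, t) = 0 by rewrite /half_remainder z0 mul0r mulr0.
exact: mule_ge0 (sym_grad_sup_ge0 t) (rd0 x).
Qed.

Lemma rel_energy_ge0 t : (0 <= rel_energy Omega phi u U t)%E.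
Proof.
apply: mule_ge0; first by rewrite lee_fin.
apply: integral_ge0 => x _; by rewrite lee_fin rel_density_ge0.
Qed.

(** The supremum norm of the symmetric gradient is not known to be measurable in
time, hence the comparison through [le_integral_ge0]. *)
Lemma spacetime_int_half_remainder_le tau : tau <= T ->
  (spacetime_int Omega tau half_remainder <= \int[lam]_(t in `[0%R, tau])
     (sym_grad_sup Q U t * rel_energy Omega phi u U t))%E.
Proof.
move=> tT; apply: le_integral_ge0 => t /=; rewrite in_itv/= => /andP[t0 tt].
  exact: mule_ge0 (sym_grad_sup_ge0 t) (rel_energy_ge0 t).
by rewrite space_int_half_remainder_le// t0 (le_trans tt).
Qed.

(** Integrating over space, U . grad (phi P) is the divergence of phi P U, since U
is solenoidal. *)
Lemma spacetime_int_strong_pressure tau : tau <= T ->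
  spacetime_int Omega tau (fun z => dot (U z) (grad phiP z)) = 0%E.
Proof.
move=> tT; have CF i : C1_compact T Q (fun z => phiP z * component i U z).
  exact: (C1_compactM T0 QT C1_phiP (CU i)).
have sF i : tsupport (fun z => phiP z * component i U z) `<=` K.
  by move=> z /(@tsupportM _ _ phiP) /(@tsupportM _ _ phi P).
have CPQ : C1_on T Q phiP by have [] := C1_phiP.
rewrite (@eq_spacetime_int _ _ _ _ _ _
    (fun z => \sum_i dx i (fun z => phiP z * component i U z) z) tT).
  apply: (spacetime_int_sum0 oOmega _ tT) => i; last first.
    exact: (spacetime_int_dx oOmega T0 oQ i tT (CF i)).
  by have [_ _ _ /(_ i)] := integrable_test (CF i) (sF i) vu.
move=> z cz; have [Qz|nQz] := pselect (Q z).
  have [_ _ /(_ _ Qz)[_ divU]] := Usol.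
  transitivity (dot (U z) (grad phiP z) + phiP z * div U z).
    by rewrite divU mulr0 addr0.
  rewrite /dot /div mulr_sumr -big_split; apply: eq_bigr => i _ /=.
  by rewrite (C1_dxM i CPQ (CU i) Qz) mxE mulrC.
have nz : ~ K z by move=> /KQ.
have [_ _ ->] := off_phiP cz nz; rewrite dot0r big1// => i _.
by have [_ _ /rowP/(_ i)] := off_support (sF i) cz nz; rewrite !mxE.
Qed.

(** Testing incompressibility at almost every time with f(., t), then integrating
in time. *)
Lemma spacetime_int_incompressible tau f : tau < T -> weak_incompressible Omega T Q u ->
  C1_compact T Q f -> tsupport f `<=` K ->
  spacetime_int Omega tau (fun z => dot (u z) (grad f z)) = 0%E.
Proof.
move=> tT inc Cf sf; have [_ _ iu _] := integrable_test Cf sf vu.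
apply: (spacetime_int_ae0 oOmega (ltW tT) iu).
apply: (@filterS _ _ (ae_filter_ringOfSetsType lam) _ _ _ inc).
move=> t + /andP[t0 tt]; apply => //.
by rewrite t0 (le_lt_trans tt).
Qed.


(** At a time where all slices are integrable every term below is a finite number,
except possibly the last integral, so the three balances may be added. *)
Lemma relative_energy_inequality_at tau : 0 < tau < T ->
  (forall x, initial_slice Q x -> U (x, 0) = u0 x) ->
  weak_incompressible Omega T Q u ->
  leb.-integrable Omega (fun x => (phi (x, tau) * enorm (u (x, tau)) ^+ 2)%:E) ->
  leb.-integrable Omega (fun x => (dot (u (x, tau)) (phiU (x, tau)))%:E) ->
  spacetime_int Omega tau momentum_flux =
    space_int Omega (fun x => dot (u (x, tau)) (phiU (x, tau))
      - dot (u0 x) (phiU (x, 0))) ->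
  (spacetime_int Omega tau energy_flux
   >= 2^-1%:E * space_int Omega (fun x => phi (x, tau) * enorm (u (x, tau)) ^+ 2)%R
      - 2^-1%:E * space_int Omega (fun x => phi (x, 0) * enorm (u0 x) ^+ 2)%R)%E ->
  (rel_energy Omega phi u U tau <= spacetime_int Omega tau rel_flux
   + 2%:E * \int[lam]_(t in `[0%R, tau])
       (sym_grad_sup Q U t * rel_energy Omega phi u U t))%E.
Proof.
move=> /andP[t0 tT] init inc ikin icross mom en.
have tT' := ltW tT; have mO : measurable Omega by exact: measurable_open_rV.
have tauT : 0 <= tau <= T by rewrite ltW.
have zT : 0 <= (0 : R) <= T by rewrite lexx ltW.
have iphiUU t : 0 <= t <= T -> leb.-integrable Omega (fun x => (phiUU (x, t))%:E).
  by move=> tt; exact: (integrable_test_slice oOmega T0 oQ tt C1_phiUU).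
have sK1 : tsupport phiUU `<=` K by exact: tsupportM.
have sK2 : tsupport phiP `<=` K by exact: tsupportM.
have [_ idt iuUU _] := integrable_test C1_phiUU sK1 vu.
have [_ _ iuP _] := integrable_test C1_phiP sK2 vu.
have [_ _ iUP _] := integrable_test C1_phiP sK2 vU1.
(* both initial energies agree with that of the strong solution *)
have u0E x : Omega x -> phi (x, 0) * enorm (u0 x) ^+ 2 = phiUU (x, 0) + phiUU (x, 0)
    /\ dot (u0 x) (phiU (x, 0)) = phiUU (x, 0) + phiUU (x, 0).
  move=> Ox; rewrite /phiUU /phiU /half_sq dotZr enorm_sqr.
  have [Qx|nQ] := pselect (Q (x, 0)); first by rewrite (init _ Qx); split; lra.
  have [-> _ _] : [/\ phi (x, 0) = 0, dt T phi (x, 0) = 0 & grad phi (x, 0) = 0].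
    by apply: off_phi => // /KQ.
  by rewrite !mul0r addr0.
have [i00 S00] := space_intD oOmega (iphiUU 0 zT) (iphiUU 0 zT).
have [itt Stt] := space_intD oOmega (iphiUU tau tauT) (iphiUU tau tauT).
have [icc Scc] := space_intD oOmega icross icross.
set phiUU_0 := space_int Omega (fun x => phiUU (x, 0)) in S00.
set phiUU_tau := space_int Omega (fun x => phiUU (x, tau)) in Stt.
set cross := space_int Omega (fun x => dot (u (x, tau)) (phiU (x, tau))) in Scc.
set kin := space_int Omega (fun x => phi (x, tau) * enorm (u (x, tau)) ^+ 2) in en.
have energy0 : space_int Omega (fun x => phi (x, 0) * enorm (u0 x) ^+ 2) =
    (phiUU_0 + phiUU_0)%E.
  by rewrite -S00; apply: eq_integral => x /set_mem /u0E[-> _].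
have momE : spacetime_int Omega tau momentum_flux = (cross - (phiUU_0 + phiUU_0))%E.
  rewrite mom -S00 -(space_intB oOmega icross i00).2.
  by apply: eq_integral => x /set_mem /u0E[_ ->].
have phiUUE : spacetime_int Omega tau (dt T phiUU) = (phiUU_tau - phiUU_0)%E.
  rewrite (spacetime_int_dt oOmega T0 oQ _ C1_phiUU idt) ?t0 ?tT'//.
  exact: (space_intB oOmega (iphiUU tau tauT) (iphiUU 0 zT)).2.
have relE : rel_energy Omega phi u U tau =
    (2^-1%:E * (kin - (cross + cross) + (phiUU_tau + phiUU_tau)))%E.
  rewrite /rel_energy -Scc -Stt; congr (_ * _)%E.
  have [ikc <-] := space_intB oOmega ikin icc.
  rewrite -(space_intD oOmega ikc itt).2.
  by apply: eq_integral => x _; congr EFin; exact: rel_density_expand.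
have ie := integrable_energy_flux; have im := integrable_momentum_flux.
have ir := integrable_rel_flux; have ih := integrable_half_remainder.
have iem := integrable_cylinderB oOmega ie im.
have iemd := integrable_cylinderD oOmega iem idt.
have iemdu := integrable_cylinderD oOmega iemd iuUU.
have iemduP := integrable_cylinderB oOmega iemdu iuP.
have ihh := integrable_cylinderD oOmega ih ih.
have hh := spacetime_intD oOmega tT' ih ih.
have rhh := spacetime_intD oOmega tT' ir ihh.
have balance : (spacetime_int Omega tau rel_flux
    + (spacetime_int Omega tau half_remainder
       + spacetime_int Omega tau half_remainder) =
    spacetime_int Omega tau energy_flux - spacetime_int Omega tau momentum_flux
    + spacetime_int Omega tau (dt T phiUU))%E.
  apply: (etrans (congr1 (adde _) (esym hh))); apply: (etrans (esym rhh)).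
  rewrite -(spacetime_intB oOmega tT' ie im) -(spacetime_intD oOmega tT' iem idt).
  rewrite -[RHS]adde0 -(spacetime_int_incompressible tT inc C1_phiUU sK1).
  rewrite -(spacetime_intD oOmega tT' iemd iuUU) -[RHS]sube0.
  rewrite -(spacetime_int_incompressible tT inc C1_phiP sK2).
  rewrite -(spacetime_intB oOmega tT' iemdu iuP) -[RHS]adde0.
  rewrite -(spacetime_int_strong_pressure tT').
  rewrite -(spacetime_intD oOmega tT' iemduP iUP).
  apply: (eq_spacetime_int tT') => z cz.
  have [Qz|nQz] := pselect (Q z); first exact: flux_identity.
  have nz : ~ K z by move=> /KQ.
  have [-> -> -> ->] := fluxes_off_support cz nz.
  have [_ -> ->] := off_phiUU cz nz; have [_ _ ->] := off_phiP cz nz.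
  by rewrite !dot0r !(addr0, subr0).
set X := (\int[lam]_(t in _) _)%E.
have IX : (spacetime_int Omega tau half_remainder <= X)%E.
  exact: spacetime_int_half_remainder_le.
apply: (@le_trans _ _ (spacetime_int Omega tau rel_flux +
    (spacetime_int Omega tau half_remainder
     + spacetime_int Omega tau half_remainder))%E); last first.
  by rewrite leeD2l// mule_natl mule2n leeD.
rewrite balance relE; move: en; rewrite energy0 momE phiUUE.
rewrite -(fineK (spacetime_int_fin_num oOmega tT' ie)).
rewrite -(fineK (_ : kin \is a fin_num)); last exact: integrable_fin_num ikin.
rewrite -(fineK (_ : cross \is a fin_num)); last exact: integrable_fin_num icross.
rewrite -(fineK (_ : phiUU_tau \is a fin_num)); last first.
  exact: integrable_fin_num (iphiUU _ tauT).
rewrite -(fineK (_ : phiUU_0 \is a fin_num)); last first.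
  exact: integrable_fin_num (iphiUU _ zT).
rewrite -?(EFinD, EFinM, EFinB, EFinN) !lee_fin; lra.
Qed.

End relative_energy.

Theorem theorem3p1 (R : realType) (d : nat) (Omega : set 'rV[R]_d) (T : R)
    (Q : set ('rV[R]_d * R)) (phi : 'rV[R]_d * R -> R)
    (u U : 'rV[R]_d * R -> 'rV[R]_d) (p P : 'rV[R]_d * R -> R)
    (u0 : 'rV[R]_d -> 'rV[R]_d) :
  (0 < d)%N -> open Omega -> connected Omega -> Omega !=set0 -> 0 < T ->
  rel_open Omega T Q ->
  C1_compact T (cylinder Omega T) phi ->
  (forall z, 0 <= phi z) ->
  tsupport phi `<=` Q ->
  admissible_weak_solution Omega T Q u p u0 ->
  strong_solution T Q U P ->
  (forall x, initial_slice Q x -> U (x, 0) = u0 x) ->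
  (forall i, C1_initial Q (fun x => u0 x 0 i)) ->
  {ae @lebesgue_measure R, forall tau : R, 0 < tau < T ->
    (rel_energy Omega phi u U tau
     <= spacetime_int Omega tau (fun z =>
          2^-1 * dt T phi z * enorm (U z - u z) ^+ 2
          + dot (grad phi z) ((enorm (U z - u z) ^+ 2 / 2) *: u z
              + (P z - p z) *: (U z - u z)))%R
        + 2%:E * \int[@lebesgue_measure R]_(t in `[0%R, tau])
            (sym_grad_sup Q U t * rel_energy Omega phi u U t))%E}.

Proof.
move=> _ oOmega _ _ T0 oQ [Cphi kphi _] phi0 phiQ [[uL3 pL32 mom inc] energy].
move=> Usol init _.
have Cphi' : C1_compact T Q phi by split => //; exact: C1_on_subset oQ _ Cphi.
have ikin := integrable_kinetic oOmega T0 oQ Cphi' uL3 pL32.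
have icross := integrable_cross oOmega T0 oQ Cphi' Usol uL3 pL32.
have FF := ae_filter_ringOfSetsType (@lebesgue_measure R).
have ae1 := @filterI _ _ FF _ _ (ae_integrable_slice oOmega ikin)
  (ae_integrable_slice oOmega icross).
have ae2 := @filterI _ _ FF _ _ mom (energy phi Cphi' phi0).
apply: (@filterS2 _ _ FF _ _ _ _ ae1 ae2).
move=> tau [kin_tau cross_tau] [mom_tau energy_tau] tauT.
have tauT' : 0 <= tau <= T by case/andP: tauT => t0 tT; rewrite !ltW.
apply: (relative_energy_inequality_at (u0 := u0) oOmega T0 oQ Cphi' phi0 Usol
  uL3 pL32) => //.
- exact: kin_tau.
- exact: cross_tau.
- by apply: (mom_tau tauT (phiU phi U)) => i; exact: (C1_phiU T0 oQ Cphi' Usol).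
- exact: energy_tau.
Qed.
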